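(* Let $M$ be a smooth Riemannian manifold, $\Sigma \subset M$ a compact set, $b \in \mathbb{R}$, and $g: M \setminus \Sigma \to \mathbb{R}$ a $C^2$ function which is fast decreasing at $\Sigma$ under level $b$. Assume also that $g^{-1}((-\infty,b]) \cup \Sigma$ is compact. Then $\Sigma$ is a strong deformation retract of $g^{-1}((-\infty,b]) \cup \Sigma$.
   Context: Definition (fast decreasing function). Let $M$ be a smooth Riemannian manifold and let $g: M \setminus \Sigma \to \mathbb{R}$ be a $C^1$ function defined outside a compact set $\Sigma \subset M$. One says that $g$ is a fast decreasing function at $\Sigma$ under level $b \in \mathbb{R}$ if both of the following hold: (i) $\lim_{x \to z} g(x) = -\infty$ for every $z \in \Sigma$, i.e. $g(x_n)\to -\infty$ whenever $(x_n)$ is a sequence in $M\setminus\Sigma$ converging to a point $z \in \Sigma$; (ii) there is a strictly positive continuous function $\phi:(-\infty, b] \to \mathbb{R}$ having a bounded primitive on $(-\infty,b]$, such that for every $x \in M\setminus \Sigma$, $g(x) \leq b$ implies $\|\nabla g(x)\| > 1/\phi(g(x))$. Here $\nabla g$ and $\|\cdot\|$ are the gradient and norm with respect to the Riemannian metric. *)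

(* Defs.v *)
From HB Require Import structures.
From mathcomp Require Import all_boot all_order all_algebra.
From mathcomp Require Import all_classical all_reals all_analysis.
Set Implicit Arguments.
Unset Strict Implicit.
Unset Printing Implicit Defensive.
Import Order.TTheory GRing.Theory Num.Theory.
Import numFieldNormedType.Exports.
Local Open Scope classical_set_scope.
Local Open Scope ring_scope.

Definition partial (R : realType) (n : nat) (V : normedModType R)
    (i : 'I_n) (f : 'rV[R]_n -> V) : 'rV[R]_n -> V :=
  fun y => 'D_(delta_mx 0 i) f y.

(* Meant for open U: all partial derivatives of order at most k exist and are
   continuous on U. *)
Fixpoint Ck_on (R : realType) (n : nat) (V : normedModType R) (k : nat)
    (U : set 'rV[R]_n) (f : 'rV[R]_n -> V) : Prop :=
  (forall y, U y -> {for y, continuous f}) /\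
  if k is k'.+1 then
    forall i : 'I_n,
      (forall y, U y -> derivable f y (delta_mx 0 i)) /\
      Ck_on k' U (partial i f)
  else True.

Definition smooth_on (R : realType) (n : nat) (V : normedModType R)
    (U : set 'rV[R]_n) (f : 'rV[R]_n -> V) : Prop :=
  forall k, Ck_on k U f.

(* A homeomorphism from an open subset of X onto an open subset of R^n; the
   values of chart_map and chart_inv outside these sets are irrelevant. *)
Record chart (R : realType) (n : nat) (X : topologicalType) := Chart {
  chart_dom : set X ;
  chart_map : X -> 'rV[R]_n ;
  chart_inv : 'rV[R]_n -> X ;
  chart_dom_open : open chart_dom ;
  chart_img_open : open (chart_map @` chart_dom) ;
  chart_mapK : forall x, chart_dom x -> chart_inv (chart_map x) = x ;
  chart_map_continuous :
    forall x, chart_dom x -> {for x, continuous chart_map} ;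
  chart_inv_continuous :
    forall y, (chart_map @` chart_dom) y -> {for y, continuous chart_inv}
}.

Definition transition (R : realType) (n : nat) (X : topologicalType)
    (c d : chart R n X) : 'rV[R]_n -> 'rV[R]_n :=
  chart_map d \o chart_inv c.

(* The smooth structure is the one generated by the atlas. *)
Record smoothManifold (R : realType) (n : nat) := SmoothManifold {
  mfd_space :> topologicalType ;
  mfd_hausdorff : hausdorff_space mfd_space ;
  mfd_second_countable : @second_countable mfd_space ;
  mfd_index : Type ;
  mfd_chart : mfd_index -> chart R n mfd_space ;
  mfd_cover : forall x, exists a, chart_dom (mfd_chart a) x ;
  mfd_compat : forall a a',
    smooth_on
      (chart_map (mfd_chart a) @`
        (chart_dom (mfd_chart a) `&` chart_dom (mfd_chart a')))
      (transition (mfd_chart a) (mfd_chart a'))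
}.

(* [metric a y] is the Gram matrix, at the point of coordinates y in the chart
   a, of the coordinate vector fields of a. Tangent vectors are represented by
   the row vector of their coordinates in a chart, so that those in a' are
   obtained from those in a by right multiplication by the Jacobian J. *)
Record riemannianManifold (R : realType) (n : nat) := RiemannianManifold {
  riem_mfd :> smoothManifold R n ;
  metric : mfd_index riem_mfd -> 'rV[R]_n -> 'M[R]_n ;
  metric_smooth : forall a,
    smooth_on (chart_map (mfd_chart a) @` chart_dom (mfd_chart a)) (metric a) ;
  metric_sym : forall a x, chart_dom (mfd_chart a) x ->
    (metric a (chart_map (mfd_chart a) x))^T =
    metric a (chart_map (mfd_chart a) x) ;
  metric_posdef : forall a x, chart_dom (mfd_chart a) x ->
    forall v : 'rV[R]_n, v != 0 ->
      0 < (v *m metric a (chart_map (mfd_chart a) x) *m v^T) 0 0 ;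
  metric_compat : forall a a' x,
    chart_dom (mfd_chart a) x -> chart_dom (mfd_chart a') x ->
    let J := jacobian (transition (mfd_chart a) (mfd_chart a'))
               (chart_map (mfd_chart a) x) in
    metric a (chart_map (mfd_chart a) x) =
    J *m metric a' (chart_map (mfd_chart a') x) *m J^T
}.

(* Meant for open W: only the values of f on W matter. *)
Definition Ck_on_mfd (R : realType) (n : nat) (M : smoothManifold R n)
    (k : nat) (W : set M) (f : M -> R) : Prop :=
  forall a,
    Ck_on k (chart_map (mfd_chart a) @` (chart_dom (mfd_chart a) `&` W))
      (f \o chart_inv (mfd_chart a)).

Section Gradient.
Variables (R : realType) (n : nat) (M : riemannianManifold R n).
Implicit Types (a : mfd_index M) (f : M -> R) (x : M).

Definition differential_coord a f x : 'rV[R]_n :=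
  \row_i partial i (f \o chart_inv (mfd_chart a)) (chart_map (mfd_chart a) x).

(* Coordinates in the chart a, which should contain x, of the gradient of f
   at x; see [gradient_coordP]. *)
Definition gradient_coord a f x : 'rV[R]_n :=
  differential_coord a f x *m invmx (metric a (chart_map (mfd_chart a) x)).

Definition tangent_dot a x (u v : 'rV[R]_n) : R :=
  (u *m metric a (chart_map (mfd_chart a) x) *m v^T) 0 0.

Definition tangent_norm a x (v : 'rV[R]_n) : R := Num.sqrt (tangent_dot a x v v).

Lemma metric_unit a x : chart_dom (mfd_chart a) x ->
  metric a (chart_map (mfd_chart a) x) \in unitmx.
Proof.
move=> ax; rewrite -row_free_unit -kermx_eq0; apply/rowV0P => v /sub_kermxP vG.
apply/eqP/negPn/negP => /(metric_posdef ax).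
by rewrite vG mul0mx mxE ltxx.
Qed.

Lemma gradient_coordP a f x : chart_dom (mfd_chart a) x ->
  forall w, w = gradient_coord a f x <->
    forall v, tangent_dot a x w v = (differential_coord a f x *m v^T) 0 0.
Proof.
move=> ax w; have Gu := metric_unit ax; split=> [-> v|wP].
  by rewrite /tangent_dot /gradient_coord mulmxKV.
rewrite /gradient_coord -(mulmxK Gu w); congr (_ *m _).
apply/rowP => i; have := wP (delta_mx 0 i); rewrite /tangent_dot.
by rewrite trmx_delta -!colE !mxE.
Qed.

End Gradient.

Section FastDecreasing.
Variables (R : realType) (n : nat) (M : riemannianManifold R n).

(* The functions are total, but only the values of g outside Sigma and those of
   phi and Phi on `]-oo, b] matter. The norm of the gradient does not depend on
   the chart in which it is computed, whence the quantification over all charts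
   at x. The derivative of the primitive Phi is one-sided at b. *)
Definition fast_decreasing (g : M -> R) (Sigma : set M) (b : R) : Prop :=
  (forall z, Sigma z -> forall u : nat -> M,
     (forall k, ~ Sigma (u k)) -> u k @[k --> \oo] --> z ->
     g (u k) @[k --> \oo] --> -oo) /\
  (exists phi : R -> R,
    [/\ forall t, t <= b -> 0 < phi t,
        {within `]-oo, b], continuous phi},
        exists Phi : R -> R,
          (forall t, t <= b ->
            (Phi s - Phi t) / (s - t) @[s --> within `]-oo, b] t^'] --> phi t) /\
          (exists C : R, forall t : R, t <= b -> `|Phi t| <= C) &
        forall x, ~ Sigma x -> g x <= b ->
          forall a : mfd_index M, chart_dom (mfd_chart a) x ->
            1 / phi (g x) < tangent_norm a x (gradient_coord a g x)]).

End FastDecreasing.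

Definition strong_deformation_retract (R : realType) (X : topologicalType)
    (A K : set X) : Prop :=
  A `<=` K /\
  exists H : X * R -> X,
    [/\ {within K `*` `[0 : R, 1 : R], continuous H},
        forall (x : X) (t : R), K x -> 0 <= t <= 1 -> K (H (x, t)),
        forall x, K x -> H (x, 0) = x,
        forall x, K x -> A (H (x, 1)) &
        forall (x : X) (t : R), A x -> 0 <= t <= 1 -> H (x, t) = x].

(* Main.v *)
Require Import Defs.
From HB Require Import structures.
From mathcomp Require Import all_boot all_order all_algebra.
From mathcomp Require Import all_classical all_reals all_analysis.
From mathcomp Require Import lra.
Set Implicit Arguments.
Unset Strict Implicit.
Unset Printing Implicit Defensive.
Import Order.TTheory GRing.Theory Num.Theory.
Import numFieldNormedType.Exports.
Local Open Scope classical_set_scope.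
Local Open Scope ring_scope.

(** Let K be the sublevel set united with Sigma, and let Phi be the bounded
primitive of phi. The function E equal to Phi o g - inf Phi off Sigma and to 0
on Sigma ([potential]) is continuous on K because g tends to -oo at Sigma, it
vanishes exactly on Sigma because Phi is strictly increasing, and its
Riemannian gradient has norm greater than 1 off Sigma, since this norm is
phi(g) |grad g|. Hence a path that descends steeply enough is no longer than
the amount by which E drops along it, and as E is bounded such a path
converges.

The retraction is not obtained by integrating a vector field but by composing
elementary pushes. Around a point p of K off Sigma, take a chart and move the
points of a small ball along straight lines in the direction of - grad g(p),
for a time that shrinks to 0 at the boundary of the ball ([ball_push]). By
continuity there is a number m such that, all over the ball, this direction
has Riemannian norm less than m while E drops at a rate greater than m
([descending_ball], [line_descent]).

Displacements are measured by gauges: the gauge of z is the distance to z in a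
chart, truncated at a small radius. It is a continuous function on M whose
small values characterize the neighbourhoods of z, and it is Lipschitz, with
some constant L z, for the Riemannian metric ([gauge_exists]). A push
therefore moves x to a point y such that E y <= E x and, for every z,
| gauge z y - gauge z x | <= L z (E x - E y) ([descends]). This relation is a
preorder, so it survives composition, and it forces y = x when E y = E x; in
particular the points of Sigma never move.

By compactness, a composite of finitely many pushes lowers E strictly on
{E >= e} ([push_strict]), hence by a fixed amount, and iterating it brings the
whole of K into {E <= e} ([push_below]). Compose such pushes for e = 1, 1/2,
1/3, and so on: what comes after the n-th of them changes the gauge of z by at
most L z / n, uniformly on K. So the images of each point converge, to a point
where E = 0, and the limit is continuous jointly in the point and the time
([pushes_retract]). *)

(** * Composing pushes into a retraction *)

Definition clamp (R : realType) (t : R) : R := Num.min 1 (Num.max 0 t).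

Lemma clamp_continuous (R : realType) : continuous (@clamp R).
Proof.
move=> t; apply: (@continuous_min R R (fun=> 1)); first exact: cvg_cst.
by apply: (@continuous_max R R (fun=> 0)); [exact: cvg_cst|exact: cvg_id].
Qed.

Lemma clamp_ge0 (R : realType) (t : R) : 0 <= clamp t.
Proof. by rewrite /clamp le_min ler01 le_max lexx. Qed.

Lemma clamp_le1 (R : realType) (t : R) : clamp t <= 1.
Proof. by rewrite /clamp ge_min lexx. Qed.

Lemma clamp_eq0 (R : realType) (t : R) : t <= 0 -> clamp t = 0.
Proof. by move=> t0; rewrite /clamp (max_idPl t0) (min_idPr ler01). Qed.

Lemma clamp_eq1 (R : realType) (t : R) : 1 <= t -> clamp t = 1.
Proof.
by move=> t1; rewrite /clamp (max_idPr (le_trans ler01 t1)) (min_idPl t1).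
Qed.

Section Pushes.
Variables (R : realType) (X : topologicalType) (K : set X).
Variables (E : X -> R) (gauge : X -> X -> R) (L : X -> R).
Hypotheses (X_hausdorff : hausdorff_space X) (K_compact : compact K).
Hypothesis E_ge0 : forall x, K x -> 0 <= E x.
Hypothesis E_continuous :
  forall x, K x -> E y @[y --> within K (nbhs x)] --> E x.
Hypothesis gauge_continuous : forall z, continuous (gauge z).
Hypothesis gauge_self : forall z, gauge z z = 0.
Hypothesis gauge_nbhs : forall z U, nbhs z U ->
  exists2 e : R, 0 < e & forall y, `|gauge z y| < e -> U y.
Hypothesis L_ge0 : forall z, 0 <= L z.

(** E pays for motion: every gauge varies by at most a constant times the drop
of E. With a distance d in place of the gauges this would be the order of
Caristi and Ekeland, d(x, y) <= E x - E y; the gauges, one for each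
point z, avoid the construction of a distance. *)
Definition descends (x y : X) : Prop :=
  E y <= E x /\ forall z, `|gauge z y - gauge z x| <= L z * (E x - E y).

(** Nothing relates the positions at two positive times: only the position at
time t and the starting point are compared. This makes the notion stable under
[push_then], where the time of the second push is reparametrized. *)
Record push (h : X * R -> X) : Prop := Push {
  push_stays : forall x t, K x -> K (h (x, t)) ;
  push_at0 : forall x, K x -> h (x, 0) = x ;
  push_descends : forall x t, K x -> descends x (h (x, t)) ;
  push_continuous : forall x t, K x ->
    h p @[p --> within (K `*` setT) (nbhs (x, t))] --> h (x, t)
}.

Lemma nbhs_eq (x y : X) : (forall U, nbhs x U -> U y) -> x = y.
Proof.
move=> xy; apply: X_hausdorff => A B xA yB.
by exists y; split; [exact: xy|exact: nbhs_singleton].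
Qed.

Lemma descends_refl x : descends x x.
Proof. by split=> // z; rewrite !subrr mulr0 normr0. Qed.

Lemma descends_trans y x z : descends x y -> descends y z -> descends x z.
Proof.
move=> [Exy gxy] [Eyz gyz]; split=> [|w]; first exact: le_trans Exy.
have := lerD (gyz w) (gxy w); rewrite -mulrDr => h.
have -> : E x - E z = E y - E z + (E x - E y) by lra.
apply: le_trans h; apply: le_trans (ler_normD _ _).
by rewrite addrA subrK.
Qed.

(** The gauge of x itself detects a displacement of x. *)
Lemma descends_eq x y : descends x y -> E x <= E y -> y = x.
Proof.
move=> [Exy gxy] Eyx.
have {Exy Eyx} EE : E x = E y by apply/eqP; rewrite eq_le Eyx.
apply/esym/nbhs_eq => U /gauge_nbhs[e e0]; apply.
have := gxy x; rewrite gauge_self subr0 EE subrr mulr0.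
by move=> /le_lt_trans; apply.
Qed.

Lemma cluster_le (F : set_system X) (f : X -> R) (c : R) z :
  Filter F ->
  f w @[w --> within K (nbhs z)] --> f z ->
  cluster F z -> F [set w | K w /\ f w <= c] -> f z <= c.
Proof.
move=> FF fz Fz FA; rewrite leNgt; apply/negP => cfz.
have nz : nbhs z [set w | K w -> c < f w].
  by move: fz => /cvgr_gt; apply.
have [w [[Kw fw] /(_ Kw)]] := Fz _ _ FA nz.
by rewrite ltNge fw.
Qed.

(** The points that can be reached from x form a closed set, so the relation
passes to the limits of sequences, which exist by compactness only as cluster
points. *)
Lemma cluster_descends (F : set_system X) x z : Filter F -> K z ->
  cluster F z -> F [set w | K w /\ descends x w] -> descends x z.
Proof.
move=> FF Kz Fz FA; split=> [|w].
  apply: (@cluster_le F E) => //; first exact: E_continuous.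
  by apply: filterS FA => y [Ky []].
rewrite mulrBr lerBrDr.
apply: (@cluster_le F (fun y => `|gauge w y - gauge w x| + L w * E y)) => //.
  apply: cvgD; last by apply: cvgMl_tmp; exact: E_continuous.
  apply: cvg_within_filter; apply: cvg_norm; apply: cvgB; last exact: cvg_cst.
  exact: gauge_continuous.
apply: filterS FA => y [Ky [_ /(_ w)]]; rewrite mulrBr => h; split=> //.
by rewrite -lerBrDr.
Qed.

Lemma push_then q h (theta : R -> R) : push q -> push h ->
  continuous theta -> theta 0 = 0 -> push (fun p => h (q p, theta p.2)).
Proof.
move=> pq ph ct t0; split=> [x t Kx|x Kx|x t Kx|x t Kx] /=.
- by apply: push_stays => //; exact: push_stays.
- by rewrite t0 !push_at0.
- exact: descends_trans (push_descends pq t Kx)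
                        (push_descends ph _ (push_stays pq t Kx)).
- have Kq := push_stays pq t Kx.
  move=> A /(push_continuous ph Kq) [[B C] [/= Bq Ct] BC].
  have nB : nbhs (x, t) [set p | (K `*` setT) p -> B (q p)].
    exact: (push_continuous pq Kx Bq).
  have nC : nbhs (x, t) [set p : X * R | C (theta p.2)].
    have -> : [set p : X * R | C (theta p.2)] = (theta \o snd) @^-1` C by [].
    by apply: (continuous_comp (f := snd)) => //; [exact: cvg_snd|exact: ct].
  suff : nbhs (x, t) [set p | (K `*` setT) p -> A (h (q p, theta p.2))] by [].
  apply: filterS (filterI nB nC) => -[y s] /= [hB hC] [Ky _].
  by apply: (BC (_, _)); split=> //=; [exact: hB|exact: push_stays].
Qed.

Lemma push_comp h h' : push h -> push h' -> push (fun p => h' (h p, p.2)).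
Proof.
by move=> ph ph'; apply: (push_then (theta := id)) => // x; exact: cvg_id.
Qed.

Lemma push_id : push fst.
Proof.
split=> // [x t _|x t Kx]; first exact: descends_refl.
by apply: cvg_within_filter; exact: cvg_fst.
Qed.

Lemma push_end_continuous h x t : push h -> K x ->
  h (y, t) @[y --> within K (nbhs x)] --> h (x, t).
Proof.
move=> ph Kx A /(push_continuous ph Kx) [[B C] [/= Bx Ct] BC].
apply: filterS Bx => y By Ky; apply: (BC (y, t)) => //.
by split=> //=; exact: nbhs_singleton Ct.
Qed.

Lemma E_push_continuous h x t : push h -> K x ->
  E (h (y, t)) @[y --> within K (nbhs x)] --> E (h (x, t)).
Proof.
move=> ph Kx A /(E_continuous (push_stays ph t Kx)).
move=> /(push_end_continuous ph Kx) nA.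
suff : nbhs x [set y | K y -> A (E (h (y, t)))] by [].
apply: filterS (nA : nbhs x [set y | K y -> K (h (y, t)) -> A (E (h (y, t)))]).
by move=> y hy Ky; exact: hy (push_stays ph t Ky).
Qed.

Hypothesis E_push : forall p, K p -> 0 < E p ->
  exists2 h, push h & E (h (p, 1)) < E p.

(** The pushes, directed by the inclusion of the sets where they lower E
strictly, form a filter F; compactness turns the pushes that work around each
point into a single one. The order is directed because a point that the first
of two pushes leaves at the same level has not moved, and is thus still where
the second push lowers it. *)
Lemma push_strict e : 0 < e -> exists2 h, push h &
  forall y, K y -> e <= E y -> E (h (y, 1)) < E y.
Proof.
move=> e0.
pose strict (h : X * R -> X) y := E (h (y, 1)) < E y.
pose F := filter_from push (fun h => [set h' | push h' /\ forall y, K y ->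
  strict h y -> strict h' y]).
have FF : Filter F.
  apply: filter_from_filter; first by exists fst; exact: push_id.
  move=> h h' ph ph'; exists (fun p => h' (h p, p.2)).
    exact: push_comp.
  move=> k [pk kS]; split; split=> // y Ky sy; apply: kS => //;
      rewrite /strict /=;
      have [d' _] := push_descends ph' 1 (push_stays ph 1 Ky).
    exact: le_lt_trans sy.
  have [lt|ge] := ltP (E (h (y, 1))) (E y).
    exact: le_lt_trans lt.
  by rewrite (descends_eq (push_descends ph 1 Ky)).
have /compact_near_coveringP/near_covering_withinP cK := K_compact.
have [h ph hS] : F [set h | K `<=` (fun y => e <= E y -> strict h y)].
  apply: (cK _ F (fun h y => e <= E y -> strict h y)) => x Kx.
  have [xe|ex] := ltP (E x) e.
    have /cvgr_lt/(_ _ xe) nx := E_continuous Kx.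
    exists ([set y | K y -> E y < e], setT) => /=.
      by split; [exact: nx|exact: filterT].
    by move=> [y h] [/= ye _ Ky] /(lt_le_trans (ye Ky)); rewrite ltxx.
  have [h ph hx] := E_push Kx (lt_le_trans e0 ex).
  have nx : nbhs x [set y | K y -> strict h y].
    have : E y - E (h (y, 1)) @[y --> within K (nbhs x)] --> E x - E (h (x, 1)).
      by apply: cvgB; [exact: E_continuous|exact: E_push_continuous].
    move=> /cvgr_gt/(_ 0); rewrite subr_gt0 => /(_ hx).
    by apply: filterS => y h0; rewrite /strict -subr_gt0.
  exists ([set y | K y -> strict h y],
          [set h' | push h' /\ forall y, K y -> strict h y -> strict h' y]).
    by split=> //=; exists h.
  by move=> [y h'] [/= sy [ph' h'S] Ky _]; exact: h'S (sy Ky).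
by exists h => // y Ky ey; apply: (hS h).
Qed.

(** By compactness a strict push lowers E by some fixed d on {E >= e}; iterate
it more than (max E - e) / d times. *)
Lemma push_below e : 0 < e -> exists2 h, push h &
  forall y, K y -> E (h (y, 1)) <= e.
Proof.
move=> e0; have [h ph hs] := push_strict e0.
have /compact_near_coveringP/near_covering_withinP cK := K_compact.
have [d d0 hd] : exists2 d, 0 < d & forall y, K y -> e <= E y ->
    E (h (y, 1)) <= E y - d.
  have : \forall d \near 0^'+, K `<=` (fun y => e <= E y ->
      E (h (y, 1)) <= E y - d).
    apply: cK => x Kx; have [xe|ex] := ltP (E x) e.
      have /cvgr_lt/(_ _ xe) nx := E_continuous Kx.
      exists ([set y | K y -> E y < e], setT) => /=.
        by split; [exact: nx|exact: filterT].
      by move=> [y d] [/= ye _ Ky] /(lt_le_trans (ye Ky)); rewrite ltxx.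
    have : E y - E (h (y, 1)) @[y --> within K (nbhs x)] --> E x - E (h (x, 1)).
      by apply: cvgB; [exact: E_continuous|exact: E_push_continuous].
    have m0 : 0 < E x - E (h (x, 1)) by rewrite subr_gt0 hs.
    move=> /cvgr_gt/(_ ((E x - E (h (x, 1))) / 2)) nx.
    exists ([set y | K y -> (E x - E (h (x, 1))) / 2 < E y - E (h (y, 1))],
       [set d | d < (E x - E (h (x, 1))) / 2]) => /=.
      split; last by apply: nbhs_right_lt; lra.
      by apply: nx; lra.
    by move=> [y d] [/= + dm Ky ey] => /(_ Ky) yd; lra.
  move=> nd; have [d [dK d0]] := filter_ex (filterI nd (nbhs_right_gt 0)).
  by exists d => // y Ky; exact: dK.
pose it := fix it n := if n is n'.+1 then (fun p => h (it n' p, p.2)) else fst.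
have pit n : push (it n).
  by elim: n => [|n IH]; [exact: push_id|exact: push_comp].
have itE n y : K y -> E (it n (y, 1)) <= Num.max e (E y - n%:R * d).
  move=> Ky; elim: n => [|n IH] /=.
    by rewrite mul0r subr0 le_max lexx orbT.
  have Ki := push_stays (pit n) 1 Ky.
  have [lt|ge] := ltP (E (it n (y, 1))) e.
    rewrite le_max (le_trans _ (ltW lt)) //.
    by have [] := push_descends ph 1 Ki.
  apply: le_trans (hd _ Ki ge) _; move: IH; rewrite le_max => /orP[IH|IH].
    by rewrite le_max; apply/orP; left; lra.
  by rewrite le_max; apply/orP; right; rewrite -natr1; lra.
have [n nK] : exists n, forall y, K y -> E y - n%:R * d <= e.
  have : \forall n \near \oo, K `<=` (fun y => E y - n%:R * d <= e).
    apply: cK => x Kx; have /cvgr_lt/(_ (E x + 1)) nx := E_continuous Kx.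
    exists ([set y | K y -> E y < E x + 1],
      [set n | (E x + 1) / d <= n%:R]) => /=.
      by split; [by apply: nx; lra|exact: nbhs_infty_ger].
    move=> [y n] [/= yx nx' Ky]; have := yx Ky; move: nx'.
    by rewrite ler_pdivrMr // => ? ?; lra.
  by move=> /filter_ex[n nK]; exists n => y Ky; exact: nK.
exists (it n) => // y Ky; apply: le_trans (itE n y Ky) _.
by rewrite ge_max lexx nK.
Qed.

(** The k-th push is performed while t runs from k / (k + 2) to
(k + 1) / (k + 2). Thus only finitely many pushes have begun at a time t < 1,
and all of them are complete at t = 1. Consecutive stages overlap, which is
harmless. *)
Definition stage (k : nat) (t : R) : R := clamp (k.+2%:R * t - k%:R).

Lemma stage_continuous k : continuous (stage k).
Proof.
move=> t.
have : {for t, continuous (@clamp R \o (fun s => k.+2%:R * s - k%:R))}.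
  apply: continuous_comp; last exact: clamp_continuous.
  by apply: cvgB; [apply: cvgMl_tmp; exact: cvg_id|exact: cvg_cst].
by apply.
Qed.

Lemma stage0 k : stage k 0 = 0.
Proof. by apply: clamp_eq0; rewrite mulr0 sub0r oppr_le0. Qed.

Lemma stage_eq0 k t : t <= 1 -> 2 <= k%:R * (1 - t) -> stage k t = 0.
Proof.
by move=> t1 kt; apply: clamp_eq0; rewrite -addn2 natrD; lra.
Qed.

(** H (x, t) is a cluster point of the positions Q n (x, t) after n pushes. For
t < 1 this sequence is eventually constant, from the same rank on for all
times near t, so H is locally one of the Q n. For t near 1 the gauge of z
differs by at most L z / n between Q n (x, t) and H (x, t), since E is at most
1 / n at the former; the continuity of H at t = 1 then follows from that of
Q n, as for a uniform limit. *)
Lemma pushes_retract :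
  strong_deformation_retract R [set x | K x /\ E x = 0] K.
Proof.
have /choice [h hP] : forall k, exists h, push h /\
    forall y, K y -> E (h (y, 1)) <= k.+1%:R^-1.
  move=> k.
  have [|h ph hE] := @push_below k.+1%:R^-1; first by rewrite invr_gt0.
  by exists h.
pose Q := fix Q n := if n is n'.+1 then
  (fun p => h n' (Q n' p, stage n' p.2)) else fst.
have pQ n : push (Q n).
  elim: n => [|n IH]; first exact: push_id.
  by apply: push_then IH _ _ _; [have [] := hP n|exact: stage_continuous|
    exact: stage0].
have Q_descends n m x t : K x -> (n <= m)%N ->
    descends (Q n (x, t)) (Q m (x, t)).
  move=> Kx; elim: m => [|m IH].
    by rewrite leqn0 => /eqP ->; exact: descends_refl.
  rewrite leq_eqVlt ltnS => /predU1P[->|/IH nm]; first exact: descends_refl.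
  apply: descends_trans nm _; have [phm _] := hP m.
  exact: (push_descends phm (stage m t) (push_stays (pQ m) t Kx)).
have QE n x t : K x -> n.+1%:R <= n.+2%:R * t ->
    E (Q n.+1 (x, t)) <= n.+1%:R^-1.
  move=> Kx nt; rewrite /= /stage clamp_eq1; last first.
    by move: nt; rewrite -!natr1; lra.
  by have [_] := hP n; apply; exact: push_stays.
have Q_stops N n x t : K x -> t <= 1 -> 2 <= N%:R * (1 - t) -> (N <= n)%N ->
    Q n (x, t) = Q N (x, t).
  move=> Kx t1 Nt; elim: n => [|n IH]; first by rewrite leqn0 => /eqP ->.
  rewrite leq_eqVlt ltnS => /predU1P[<-//|Nn] /=.
  rewrite IH // stage_eq0 //; last first.
    by apply: le_trans Nt _; rewrite ler_wpM2r ?subr_ge0 // ler_nat.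
  by have [phn _] := hP n; rewrite push_at0 //; exact: push_stays.
have /choice [H HP] : forall p, exists z, K p.1 ->
    K z /\ cluster (Q n p @[n --> \oo]) z.
  move=> [x t] /=; have [Kx|nKx] := pselect (K x); last by exists x.
  have [|z [Kz zc]] := K_compact (F := Q n (x, t) @[n --> \oo]).
    by exists 0%N => // n _; exact: (push_stays (pQ n) t Kx).
  by exists z.
have KH x t : K x -> K (H (x, t)) by move=> Kx; have [] := HP (x, t) Kx.
have H_descends n x t : K x -> descends (Q n (x, t)) (H (x, t)).
  move=> Kx; have [Kz zc] := HP (x, t) Kx.
  apply: cluster_descends Kz zc _.
  exists n => //= m nm; split; first exact: (push_stays (pQ m) t Kx).
  exact: Q_descends.
have H_early N x t : K x -> t <= 1 -> 2 <= N%:R * (1 - t) ->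
    H (x, t) = Q N (x, t).
  move=> Kx t1 Nt; have [_ zc] := HP (x, t) Kx.
  apply: nbhs_eq => U HU.
  have QN : (Q n (x, t) @[n --> \oo]) [set Q N (x, t)].
    by exists N => //= n /= Nn; exact: Q_stops.
  by have [_ [-> ]] := zc _ _ QN HU.
have H1 x : K x -> E (H (x, 1)) = 0.
  move=> Kx; apply/eqP; rewrite eq_le E_ge0 ?andbT; last exact: KH.
  apply/ler_addgt0Pr => e e0; rewrite add0r.
  have [n ne] : exists n, n.+1%:R^-1 < e.
    by have /filter_ex [n] := near_infty_natSinv_lt (PosNum e0); exists n.
  have [+ _] := H_descends n.+1 x 1 Kx; move=> /le_trans; apply.
  apply: le_trans (ltW ne); apply: QE => //.
  by rewrite mulr1 ler_nat.
have H_continuous (x0 : X) (t0 : R) : K x0 -> 0 <= t0 <= 1 ->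
    forall U, nbhs (H (x0, t0)) U ->
    nbhs (x0, t0) [set p | (K `*` `[0, 1]) p -> U (H p)].
  move=> Kx0 /andP[t00].
  rewrite le_eqVlt => /predU1P[->|t01]; last first.
    (* any s strictly between t0 and 1 would do *)
    pose s := (1 + t0) / 2.
    have [N Ns] : exists N, 2 / (1 - s) <= N%:R.
      have /filter_ex [N] := nbhs_infty_ger (2 / (1 - s)); by exists N.
    have s1 : 0 < 1 - s by rewrite /s; lra.
    have HQ x t : K x -> t <= s -> H (x, t) = Q N (x, t).
      move=> Kx ts; apply: H_early => //; first by lra.
      by move: Ns; rewrite ler_pdivrMr //; move=> /le_trans; apply;
        rewrite ler_wpM2l //; lra.
    have -> : H (x0, t0) = Q N (x0, t0) by apply: HQ => //; rewrite /s; lra.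
    move=> U /(push_continuous (pQ N) Kx0) nU.
    have ns : nbhs (x0, t0) [set p : X * R | p.2 < s].
      exists (setT, [set t | t < s]); last by move=> ? [].
      split; first exact: filterT.
      by apply: lt_nbhsl; change (t0 < (1 + t0) / 2); lra.
    have nU' : nbhs (x0, t0) [set p | (K `*` setT) p -> U (Q N p)] by [].
    apply: filterS (filterI nU' ns) => -[x t] [/= QU ts] [Kx _].
    by rewrite HQ //; [exact: QU|exact: ltW].
  move=> U /gauge_nbhs [e e0 eU].
  set z := H (x0, 1) in eU *.
  (* The gauge of z at H (x, t) is compared with that at H (x0, 1), which is 0,
     through the points Q n.+1 (x, t) and Q n.+1 (x0, 1): three errors, each
     less than e / 3. *)
  have [n ne] : exists n, 3 * (L z + 1) / e < n.+1%:R.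
    have /filter_ex [n] := nbhs_infty_gtr (3 * (L z + 1) / e); exists n.
    by apply: lt_trans p _; rewrite ltr_nat.
  have Lz : L z * n.+1%:R^-1 < e / 3.
    rewrite ltr_pdivrMr //; move: ne; rewrite ltr_pdivrMr // => ne.
    by lra.
  have close x t : K x -> n.+1%:R <= n.+2%:R * t ->
      `|gauge z (H (x, t)) - gauge z (Q n.+1 (x, t))| < e / 3.
    move=> Kx nt; have [_ /(_ z) g] := H_descends n.+1 x t Kx.
    apply: le_lt_trans g (le_lt_trans _ Lz); rewrite ler_wpM2l //.
    rewrite lerBlDr (le_trans (QE n x t Kx nt)) // lerDl.
    by apply: E_ge0; exact: KH.
  have n1 : n.+1%:R < n.+2%:R :> R by rewrite ltr_nat.
  have ns : nbhs (x0, 1 : R) [set p : X * R | n.+1%:R <= n.+2%:R * p.2].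
    exists (setT, [set t | n.+1%:R / n.+2%:R < t]).
      by split; [exact: filterT|apply: lt_nbhsr; rewrite ltr_pdivrMr ?mul1r].
    by move=> -[x t] [/= _]; rewrite ltr_pdivrMr // mulrC => /ltW.
  have nq : nbhs (x0, 1 : R) [set p | K p.1 ->
      `|gauge z (Q n.+1 (x0, 1)) - gauge z (Q n.+1 p)| < e / 3].
    have := gauge_continuous (z := z) (x := Q n.+1 (x0, 1)).
    move=> /cvgr_dist_lt/(_ (e / 3)); rewrite divr_gt0 // => /(_ isT).
    move=> /(push_continuous (pQ n.+1) Kx0) nU.
    have nU' : nbhs (x0, 1 : R) [set p | (K `*` setT) p ->
      `|gauge z (Q n.+1 (x0, 1)) - gauge z (Q n.+1 p)| < e / 3] by [].
    by apply: filterS nU' => -[x t] + Kx; apply.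
  apply: filterS (filterI ns nq) => -[x t] [/= nt qt] [/= Kx _].
  apply: eU.
  have /= c1 := close x t Kx nt.
  have c2 : `|gauge z (H (x0, 1)) - gauge z (Q n.+1 (x0, 1))| < e / 3.
    by apply: close => //; rewrite mulr1 ltW.
  have c3 := qt Kx; move: c2; rewrite -/z gauge_self => c2.
  move: c1 c2 c3; rewrite !ltr_norml => /andP[? ?] /andP[? ?] /andP[? ?].
  by apply/andP; split; lra.
split=> [x []//|]; exists H; split.
- apply/subspace_continuousP => -[x0 t0] [/= Kx0 /[!in_itv]/= t01] U.
  exact: H_continuous.
- by move=> x t Kx _; exact: KH.
- move=> x Kx; rewrite (H_early 2%N) //; last by rewrite subr0 mulr1.
  exact: (push_at0 (pQ 2%N) Kx).
- by move=> x Kx; split; [exact: KH|exact: H1].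
- move=> x t [Kx Ex0] _.
  apply: descends_eq; first exact: (H_descends 0%N x t Kx).
  by rewrite Ex0; apply: E_ge0; exact: KH.
Qed.

End Pushes.

(** * Calculus along segments *)

(** The supremum of the points up to which f stays below f a must be b. No
continuity is assumed: the comparison at s with the points on both sides of s
replaces it. *)
Lemma local_nonincreasing (R : realType) (f : R -> R) (a b : R) :
  (forall s, a <= s <= b -> \forall s' \near s, a <= s' <= b ->
     (s <= s' -> f s' <= f s) /\ (s' <= s -> f s <= f s')) ->
  a <= b -> f b <= f a.
Proof.
move=> floc ab.
pose S := [set s | a <= s <= b /\ f s <= f a].
have S_sup : has_sup S.
  by split; [exists a; split; rewrite ?lexx|exists b => s [/andP[]]].
pose c := sup S.
have ac : a <= c by apply: (ub_le_sup S_sup.2); split; rewrite ?lexx.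
have cb : c <= b by apply: ge_sup S_sup.1 _ => s [/andP[]].
have cab : a <= c <= b by rewrite ac.
have /nbhs_ballP[d /= d0 cd] := floc c cab.
have fc : f c <= f a.
  have [s [sab fs] cs] := sup_adherent d0 S_sup.
  have sc : s <= c by apply: (ub_le_sup S_sup.2); split.
  apply: le_trans fs; have [|//|_] := cd s; last exact.
  by rewrite /ball /= ger0_norm ?subr_ge0 // -/c in cs *; lra.
have [<-//|/eqP cNb] := pselect (c = b).
have {cNb} cb' : c < b by rewrite lt_neqAle cNb.
pose s' := Num.min b (c + d / 2).
have cs' : c < s' by rewrite lt_min cb'; lra.
have s'b : s' <= b by rewrite ge_min lexx.
have s'd : s' <= c + d / 2 by rewrite ge_min lexx orbT.
have s'ab : a <= s' <= b by rewrite s'b (le_trans ac (ltW cs')).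
have [|/(_ (ltW cs')) fs' _] := cd s' _ s'ab.
  by rewrite /ball /= ltr0_norm ?subr_lt0 //; lra.
have /(ub_le_sup S_sup.2) : S s' by split=> //; exact: le_trans fs' fc.
by rewrite -/c leNgt cs'.
Qed.

(** Apply [local_nonincreasing] to | f s - f a | - m (s - a). This is the mean
value inequality for maps with values in a normed space. *)
Lemma local_lipschitz (R : realType) (V : normedModType R) (f : R -> V)
    (m a b : R) :
  (forall s, a <= s <= b -> \forall s' \near s, a <= s' <= b ->
     `|f s' - f s| <= m * `|s' - s|) ->
  a <= b -> `|f b - f a| <= m * (b - a).
Proof.
move=> floc ab.
have := @local_nonincreasing R (fun s => `|f s - f a| - m * (s - a)) a b _ ab.
rewrite !subrr normr0 mulr0 subrr subr_le0; apply => s sab.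
have := floc s sab; apply: filterS => s' fs' /fs' {}fs'.
have t1 : `|f s' - f a| <= `|f s' - f s| + `|f s - f a|.
  by apply: le_trans (ler_normD _ _); rewrite addrA subrK.
have t2 : `|f s - f a| <= `|f s' - f s| + `|f s' - f a|.
  rewrite (distrC (f s')); apply: le_trans (ler_normD _ _).
  by rewrite addrA subrK.
split=> ss'; move: fs'.
  by rewrite ger0_norm ?subr_ge0 // => ?; lra.
by rewrite ler0_norm ?subr_le0 // => ?; lra.
Qed.

Lemma derivable_near (R : realType) (V W : normedModType R) (f : V -> W)
    (x v : V) (e : R) : derivable f x v -> 0 < e ->
  \forall h \near (0 : R),
    `|f (h *: v + x) - f x - h *: 'D_v f x| <= e * `|h|.
Proof.
move=> /derivable_nbhs/eqaddoP/(_ _)/[apply].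
apply: filterS => h /=; rewrite opprD.
by rewrite -![(_ + _ : _ -> _) _]/(_ + _) -![(- _ : _ -> _) _]/(- _) /= addrA.
Qed.

Lemma near0_shift (R : realType) (s : R) (P : R -> Prop) :
  (\forall h \near (0 : R), P (s + h)) -> \forall s' \near s, P s'.
Proof.
by rewrite (near_shift 0 s) subr0; apply: filterS => h /=; rewrite addrC.
Qed.

Lemma line_near (R : realType) (V W : normedModType R) (f : V -> W) (x v : V)
    (s e : R) :
  derivable f (s *: v + x) v -> 0 < e -> \forall s' \near s,
  `|f (s' *: v + x) - f (s *: v + x) - (s' - s) *: 'D_v f (s *: v + x)|
    <= e * `|s' - s|.
Proof.
move=> df e0; apply: near0_shift; apply: filterS (derivable_near df e0) => h.
by rewrite addrA -scalerDl (addrC h s) (addrC s h) addrK.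
Qed.

(** The slack in m < p q is shared between the two factors: a rate p q of a
composite bounds it by m even after both factors are slightly lowered. *)
Lemma lt_mul_split (R : realType) (m p q : R) : 0 < m -> 0 < p -> m < p * q ->
  exists p1 q1, [/\ 0 < p1, p1 < p, 0 < q1, q1 < q & m = p1 * q1].
Proof.
move=> m0 p0 mpq; pose q1 := (q + m / p) / 2.
have mq : m / p < q by rewrite ltr_pdivrMr // mulrC.
have mp0 : 0 < m / p by rewrite divr_gt0.
have q10 : 0 < q1 by rewrite /q1; lra.
exists (m / q1), q1; split=> //; [by rewrite divr_gt0| |by rewrite /q1; lra|].
  by rewrite ltr_pdivrMr // mulrC -ltr_pdivrMr // /q1; lra.
by rewrite divfK // gt_eqF.
Qed.

Lemma nbhs_closed_norm_ball (R : realType) (V : normedModType R) (v : V)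
    (A : set V) :
  nbhs v A -> exists2 r : R, 0 < r & forall w, `|w - v| <= r -> A w.
Proof.
move=> /nbhs_closedballP[r rA]; exists r%:num => // w wv.
by apply: rA; rewrite closed_ballE // /closed_ball_ /= distrC.
Qed.

Lemma line_continuous (R : realType) (V : normedModType R) (v w : V) :
  h *: v + w @[h --> (0 : R)] --> w.
Proof.
rewrite -[X in _ --> X]add0r -(scale0r v).
by apply: cvgD; [apply: cvgZr_tmp; exact: cvg_id|exact: cvg_cst].
Qed.

Lemma near_line (R : realType) (V : normedModType R) (v w : V) (A : set V) :
  nbhs w A ->
  \forall h \near (0 : R), A (h *: v + w).
Proof. exact: line_continuous. Qed.

(** * Continuously differentiable maps *)

Section ContinuouslyDifferentiable.
Variables (R : realType) (n : nat) (V : normedModType R).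
Implicit Types (f : 'rV[R]_n -> V) (x y h : 'rV[R]_n).

(** The mean value inequality for the difference between f and its linear
approximation, along a segment in a coordinate direction. The factor 2 comes
from the error e on the derivative and an error e in the difference
quotients. *)
Lemma partial_increment f (i : 'I_n) (D : V) (B : set 'rV[R]_n) (e : R) y t :
  0 < e ->
  (forall z, B z ->
     derivable f z (delta_mx 0 i) /\ `|partial i f z - D| <= e) ->
  (forall s, 0 <= s <= 1 -> B ((s * t) *: delta_mx 0 i + y)) ->
  `|f (t *: delta_mx 0 i + y) - f y - t *: D| <= (2 * e) * `|t|.
Proof.
move=> e0 fB By; set v : 'rV[R]_n := delta_mx 0 i in fB By *.
have := @local_lipschitz R V
  (fun s => f ((s * t) *: v + y) - (s * t) *: D) (2 * e * `|t|) 0 1 _ ler01.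
rewrite !mul0r !scale0r add0r !subr0 mulr1 !mul1r addrAC; apply => s s01.
have [fz fD] := fB _ (By s s01); set z := _ + y in fz fD *.
have ht : (s' - s) * t @[s' --> s] --> (0 : R).
  rewrite -(mul0r t) -(subrr s); apply: cvgMr_tmp.
  by apply: cvgB; [exact: cvg_id|exact: cvg_cst].
have nh : \forall s' \near s, `|f (((s' - s) * t) *: v + z) - f z
    - ((s' - s) * t) *: partial i f z| <= e * `|(s' - s) * t|.
  exact: ht (derivable_near fz e0).
apply: filterS nh => s'.
have -> : ((s' - s) * t) *: v + z = (s' * t) *: v + y.
  by rewrite /z addrA -scalerDl -mulrDl subrK.
move=> fs' _; set h := (s' - s) * t in fs' *.
have -> : f ((s' * t) *: v + y) - (s' * t) *: D - (f z - (s * t) *: D) =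
    (f ((s' * t) *: v + y) - f z - h *: partial i f z)
    + h *: (partial i f z - D).
  rewrite /h scalerBr addrA subrK mulrBl scalerBl !opprB !addrA.
  by rewrite [in LHS]addrAC -!addrA; congr (_ + _); rewrite addrC -addrA.
apply: le_trans (ler_normD _ _) _; rewrite normrZ.
have hE : `|h| = `|t| * `|s' - s| by rewrite normrM mulrC.
have hD : `|h| * `|partial i f z - D| <= `|h| * e by rewrite ler_wpM2l.
by rewrite -mulrA -hE; lra.
Qed.

Definition coord_combination (D : 'I_n -> V) h : V := \sum_i h 0 i *: D i.

Fact coord_combination_is_linear D : linear (coord_combination D).
Proof.
move=> c u v; rewrite /coord_combination scaler_sumr -big_split /=.
by apply: eq_bigr => i _; rewrite !mxE scalerDl scalerA.
Qed.

HB.instance Definition _ D :=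
  GRing.isLinear.Build R 'rV[R]_n V _ (coord_combination D)
    (coord_combination_is_linear D).

Lemma coord_combination_continuous D : continuous (coord_combination D).
Proof.
move=> x; apply: cvg_big => [||i _]; first exact: add_continuous.
  exact: nbhs_filter.
apply: cvgZr_tmp; [exact: nbhs_filter|exact: coord_continuous].
Qed.

Lemma norm_coord_le (h : 'rV[R]_n) i : `|h 0 i| <= `|h|.
Proof.
rewrite /Num.norm /= mx_normrE.
exact: (le_bigmax _ (fun ij : 'I_1 * 'I_n => `|h ij.1 ij.2|) (0, i)).
Qed.

Lemma norm_row_le (h : 'rV[R]_n) (c : R) : 0 <= c ->
  (forall i, `|h 0 i| <= c) -> `|h| <= c.
Proof.
move=> c0 hc; rewrite /Num.norm /= mx_normrE.
by apply: bigmax_le => // -[i j] _ /=; rewrite ord1.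
Qed.

(** Go from x to x + h by changing one coordinate at a time: [cut k] is h with
the coordinates from k on replaced by 0. The intermediate points stay within
the distance | h | of x for the sup norm. *)
Lemma partial_total_increment f (D : 'I_n -> V) x (r e : R) h :
  0 < e ->
  (forall i z, `|z - x| <= r ->
     derivable f z (delta_mx 0 i) /\ `|partial i f z - D i| <= e) ->
  `|h| <= r ->
  `|f (x + h) - f x - coord_combination D h| <= n%:R * (2 * e) * `|h|.
Proof.
move=> e0 fB hr.
pose cut k : 'rV[R]_n := \row_j (if (j < k)%N then h 0 j else 0).
have cutn : cut n = h by apply/rowP => j; rewrite mxE ltn_ord.
have cut0 : cut 0%N = 0 by apply/rowP => j; rewrite !mxE.
suff main k : (k <= n)%N -> `|f (x + cut k) - f x -
    \sum_(i < n | (i < k)%N) h 0 i *: D i| <= k%:R * (2 * e) * `|h|.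
  have := main n (leqnn n); rewrite cutn /coord_combination.
  by rewrite (eq_bigl predT) // => i; rewrite ltn_ord.
elim: k => [_|k IH kn].
  by rewrite cut0 addr0 subrr big1 ?subr0 ?normr0 // !mul0r.
pose i := Ordinal kn.
have cutS : cut k.+1 = h 0 i *: delta_mx 0 i + cut k.
  apply/rowP => j; rewrite !mxE eqxx /= ltnS leq_eqVlt.
  have [->|ji] := eqVneq j i; first by rewrite eqxx /= ltnn mulr1 addr0.
  by rewrite (negbTE (ji : val j != val i)) mulr0 add0r.
have step : `|f (h 0 i *: delta_mx 0 i + (x + cut k)) - f (x + cut k)
      - h 0 i *: D i| <= 2 * e * `|h 0 i|.
  apply: (partial_increment (B := [set z | `|z - x| <= r])) => //
    [z|s /andP[s0 s1]] /=; first exact: fB.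
  have -> : (s * h 0 i) *: delta_mx 0 i + (x + cut k) - x =
      (s * h 0 i) *: delta_mx 0 i + cut k.
    by rewrite addrCA addrAC subrr add0r.
  apply: le_trans hr.
  apply: norm_row_le => // j; rewrite !mxE eqxx /=.
  have [->|ji] := eqVneq j i.
    rewrite ltnn addr0 mulr1 normrM (ger0_norm s0).
    by apply: le_trans (norm_coord_le h i); rewrite ler_piMl.
  rewrite mulr0 add0r; case: ifP => _; first exact: norm_coord_le.
  by rewrite normr0.
rewrite (bigD1 i) //= (eq_bigl (fun j : 'I_n => (j < k)%N)); last first.
  by move=> j; rewrite ltnS ltn_neqAle andbC.
have -> : f (x + cut k.+1) - f x - (h 0 i *: D i +
      \sum_(j < n | (j < k)%N) h 0 j *: D j) =
    (f (h 0 i *: delta_mx 0 i + (x + cut k)) - f (x + cut k) - h 0 i *: D i) +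
    (f (x + cut k) - f x - \sum_(j < n | (j < k)%N) h 0 j *: D j).
  by rewrite cutS (addrCA x) [RHS]addrACA [_ + (_ - f x)]addrA subrK opprD.
apply: le_trans (ler_normD _ _) _.
have hi := norm_coord_le h i; have IHk := IH (ltnW kn).
rewrite -natr1.
have : 2 * e * `|h 0 i| <= 2 * e * `|h| by rewrite ler_wpM2l //; lra.
by lra.
Qed.

(** By [partial_total_increment] with e arbitrarily small. The change of charts
for the metric is stated with Jacobians, which are tied to derivatives along
vectors only for differentiable maps. *)
Lemma C1_differentiable (U : set 'rV[R]_n) f x :
  open U -> Ck_on 1 U f -> U x -> differentiable f x.
Proof.
move=> oU [_ fU] Ux.
have nU : nbhs x U by exact: open_nbhs_nbhs.
pose D i := partial i f x.
pose df : {linear 'rV[R]_n -> V} := coord_combination D.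
have o_small : f \o shift x = cst (f x) + df +o_ (0 : 'rV[R]_n) id.
  apply/eqaddoP => e e0.
  pose e' := e / (2 * n.+1%:R).
  have e'0 : 0 < e' by rewrite divr_gt0 // mulr_gt0.
  have near_i i : \forall z \near x,
      derivable f z (delta_mx 0 i) /\ `|partial i f z - D i| <= e'.
    have [fi [ci _]] := fU i.
    have nd : \forall z \near x, `|partial i f z - D i| < e'.
      by have /cvgrPdistC_lt/(_ e' e'0) := ci x Ux.
    by apply: filterS2 nU nd => z Uz ze; split; [exact: fi|exact: ltW].
  have : \forall z \near x, forall i,
      derivable f z (delta_mx 0 i) /\ `|partial i f z - D i| <= e'.
    exact: filter_forall near_i.
  move=> /nbhs_closedballP[r rP].
  apply/nbhs_ballP; exists r%:num => //= h.
  rewrite -ball_normE /= sub0r normrN => hr.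
  have fB i z : `|z - x| <= r%:num ->
      derivable f z (delta_mx 0 i) /\ `|partial i f z - D i| <= e'.
    by move=> zx; apply: rP; rewrite closed_ballE // /closed_ball_ /= distrC.
  have := partial_total_increment e'0 fB (ltW hr).
  rewrite [x + h]addrC opprD.
  rewrite -![(_ + _ : _ -> _) _]/(_ + _) -![(- _ : _ -> _) _]/(- _) /= addrA.
  move=> /le_trans; apply; rewrite ler_wpM2r //.
  have eE : e = e' * (2 * (n%:R + 1)) by rewrite natr1 divfK // mulf_neq0.
  by rewrite [leRHS]eE; lra.
apply/diff_locallyP.
have dfE : 'd f x = df :> ('rV[R]_n -> V).
  by apply: diff_unique => //; exact: coord_combination_continuous.
by rewrite dfE; split=> //; exact: coord_combination_continuous.
Qed.

End ContinuouslyDifferentiable.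

(** * Balls in charts and truncated distances *)
Section Charts.
Variables (R : realType) (n : nat) (X : topologicalType).
Hypothesis X_hausdorff : hausdorff_space X.
Implicit Types (c : chart R n X) (x : X) (y : 'rV[R]_n).

Definition chart_img c : set 'rV[R]_n := chart_map c @` chart_dom c.

Lemma chart_img_map c x : chart_dom c x -> chart_img c (chart_map c x).
Proof. by move=> cx; exists x. Qed.

Lemma chart_dom_inv c y : chart_img c y -> chart_dom c (chart_inv c y).
Proof. by move=> [x cx <-]; rewrite chart_mapK. Qed.

Lemma chart_invK c y : chart_img c y -> chart_map c (chart_inv c y) = y.
Proof. by move=> [x cx <-]; rewrite chart_mapK. Qed.

Lemma chart_dom_nbhs c x : chart_dom c x -> nbhs x (chart_dom c).
Proof.
by move=> cx; apply: open_nbhs_nbhs; split=> //; exact: chart_dom_open.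
Qed.

Lemma chart_img_nbhs c y : chart_img c y -> nbhs y (chart_img c).
Proof.
by move=> cy; apply: open_nbhs_nbhs; split=> //; exact: chart_img_open.
Qed.

Lemma chart_img_open_sub c (W : set X) : open W ->
  open (chart_map c @` (chart_dom c `&` W)).
Proof.
move=> oW; rewrite openE => _ [x [cx Wx] <-]; rewrite /interior.
have cy := chart_img_map cx.
have nW : nbhs (chart_map c x) (chart_inv c @^-1` W).
  apply: chart_inv_continuous => //.
  by rewrite chart_mapK //; exact: open_nbhs_nbhs.
apply: filterS (filterI (chart_img_nbhs cy) nW) => y [yc Wy].
exists (chart_inv c y); last exact: chart_invK.
by split=> //; exact: chart_dom_inv.
Qed.

Definition chart_ball c y r : set X :=
  [set x | chart_dom c x /\ `|chart_map c x - y| <= r].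

(** It is the image of a compact ball, and the space is Hausdorff. Without
this a function equal to a constant outside the ball could fail to be
continuous at a point outside the domain of the chart. *)
Lemma chart_ball_closed c y r : 0 < r ->
  (forall y', `|y' - y| <= r -> chart_img c y') -> closed (chart_ball c y r).
Proof.
move=> r0 rc; apply: compact_closed => //.
have -> : chart_ball c y r = chart_inv c @` closed_ball y r.
  rewrite closed_ballE // /closed_ball_ /=; apply/seteqP; split=> x.
    move=> [cx xr]; exists (chart_map c x); last exact: chart_mapK.
    by rewrite /= distrC.
  move=> [y' /=]; rewrite distrC => /[dup] yr /rc cy <-.
  by split; [exact: chart_dom_inv|rewrite chart_invK].
apply: continuous_compact.
  apply/subspace_continuousP => y' y'r; apply: cvg_within_filter.
  apply: chart_inv_continuous; apply: rc.
  by move: y'r; rewrite closed_ballE // /closed_ball_ /= distrC.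
apply: bounded_closed_compact; last exact: closed_ball_closed.
rewrite closed_ballE //; exists (`|y| + r); split; first exact: num_real.
move=> M yM y' /= y'r; apply: le_trans (ltW yM).
rewrite -[y'](subrK y) addrC; apply: le_trans (ler_normD _ _) _.
by rewrite lerD2l distrC.
Qed.

Lemma near_outside_chart_ball c y r x : 0 < r ->
  (forall y', `|y' - y| <= r -> chart_img c y') -> ~ chart_ball c y r x ->
  \forall x' \near x, ~ chart_ball c y r x'.
Proof.
move=> r0 rc xr; apply: open_nbhs_nbhs; split=> //.
by apply/closed_openC/chart_ball_closed.
Qed.

(** The distance to z in the chart c, truncated at r. The two branches agree
near the border of the domain of c when the ball of radius r is contained in
the image of c. *)
Definition chart_gauge c z r x : R :=
  if `[< chart_dom c x >]
  then Num.min `|chart_map c x - chart_map c z| r else r.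

Lemma chart_gauge_in c z r x : chart_dom c x ->
  chart_gauge c z r x = Num.min `|chart_map c x - chart_map c z| r.
Proof. by rewrite /chart_gauge => /asboolP ->. Qed.

Lemma chart_gauge_out c z r x : ~ chart_ball c (chart_map c z) r x ->
  chart_gauge c z r x = r.
Proof.
move=> xr; rewrite /chart_gauge; case: asboolP => // cx.
by apply/min_idPr; rewrite leNgt; apply/negP => /ltW xr'; apply: xr.
Qed.

Section Gauge.
Variables (c : chart R n X) (z : X) (r : R).
Hypotheses (cz : chart_dom c z) (r0 : 0 < r).
Hypothesis rc : forall y, `|y - chart_map c z| <= r -> chart_img c y.

Lemma chart_gauge_self : chart_gauge c z r z = 0.
Proof. by rewrite chart_gauge_in // subrr normr0 (min_idPl (ltW r0)). Qed.

Lemma chart_gauge_continuous : continuous (chart_gauge c z r).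
Proof.
move=> x; have [cx|ncx] := pselect (chart_dom c x).
  rewrite /continuous_at chart_gauge_in //.
  have nE : \forall x' \near x, Num.min `|chart_map c x' - chart_map c z| r =
      chart_gauge c z r x'.
    by apply: filterS (chart_dom_nbhs cx) => x' cx'; rewrite chart_gauge_in.
  apply: (cvg_trans (near_eq_cvg nE)).
  apply: (@continuous_min R X (fun x => `|chart_map c x - chart_map c z|)
    (fun=> r)); last exact: cvg_cst.
  apply: cvg_norm; apply: cvgB; last exact: cvg_cst.
  exact: chart_map_continuous.
have xr : ~ chart_ball c (chart_map c z) r x by case.
rewrite /continuous_at chart_gauge_out //.
apply: cvg_near_cst.
by apply: filterS (near_outside_chart_ball r0 rc xr) => x' /chart_gauge_out.
Qed.

Lemma chart_gauge_nbhs U : nbhs z U ->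
  exists2 e : R, 0 < e & forall x, `|chart_gauge c z r x| < e -> U x.
Proof.
move=> zU; have cz' := chart_img_map cz.
have : nbhs (chart_map c z) (chart_inv c @^-1` U).
  by apply: chart_inv_continuous => //; rewrite chart_mapK.
move=> /nbhs_closed_norm_ball[e e0 eU]; exists (Num.min e r).
  by rewrite lt_min e0.
move=> x /(le_lt_trans (ler_norm _)); rewrite lt_min /chart_gauge.
case: asboolP => [cx|]; last by rewrite ltxx andbF.
rewrite !gt_min ltxx orbF => /andP[/orP[xe _|re xr]].
  by rewrite -(chart_mapK cx); apply: eU; exact: ltW.
by rewrite -(chart_mapK cx); apply: eU; apply: ltW; exact: lt_trans re.
Qed.

End Gauge.
End Charts.

(** * Comparison with the Riemannian metric *)
Section QuadraticForms.
Variables (R : realType) (n : nat).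
Implicit Types (A : 'M[R]_n) (v w : 'rV[R]_n).

Definition quad_form A w : R := (w *m A *m w^T) 0 0.

Lemma quad_formE A w : quad_form A w = \sum_j (\sum_i w 0 i * A i j) * w 0 j.
Proof.
by rewrite /quad_form mxE; apply: eq_bigr => j _; rewrite !mxE.
Qed.

Lemma quad_formZ A w (k : R) : quad_form A (k *: w) = k ^+ 2 * quad_form A w.
Proof.
by rewrite /quad_form linearZ /= -scalemxAr -!scalemxAl !mxE expr2 mulrA.
Qed.

Lemma quad_form_cvg (T : Type) (F : set_system T) (FF : Filter F)
    (Af : T -> 'M[R]_n) (wf : T -> 'rV[R]_n) A w :
  Af t @[t --> F] --> A -> wf t @[t --> F] --> w ->
  quad_form (Af t) (wf t) @[t --> F] --> quad_form A w.
Proof.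
move=> FA Fw; rewrite quad_formE; under eq_cvg do rewrite quad_formE.
have entry m1 m2 (Bf : T -> 'M[R]_(m1, m2)) (B : 'M[R]_(m1, m2)) i j :
    Bf t @[t --> F] --> B -> Bf t i j @[t --> F] --> B i j.
  move=> FB.
    exact: (continuous_cvg _ (@coord_continuous R m1 m2 i j B) FB).
apply: cvg_big => [|j _]; first exact: add_continuous.
apply: cvgM; last exact: entry.
apply: cvg_big => [|i _]; first exact: add_continuous.
by apply: cvgM; exact: entry.
Qed.

(** The form is positive on the compact unit sphere at y, hence bounded below
there by a positive constant that serves for all y' near y. *)
Lemma quad_form_coercive (G : 'rV[R]_n -> 'M[R]_n) y : {for y, continuous G} ->
  (forall w, w != 0 -> 0 < quad_form (G y) w) ->
  exists2 k : R, 0 < k &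
    \forall y' \near y, forall w, k * `|w| <= Num.sqrt (quad_form (G y') w).
Proof.
move=> Gy Gpos.
pose S := [set w : 'rV[R]_n | `|w| = 1].
have cS : compact S.
  apply: bounded_closed_compact.
    by exists 1; split; [exact: num_real|move=> M M1 w /= ->; exact: ltW].
  have -> : S = Num.norm @^-1` [set 1] by [].
  apply: preimage_closed; last exact: closed_eq.
  by move=> w _; exact: norm_continuous.
have /compact_near_coveringP cov := cS.
pose F := filter_prod (nbhs y) ((0 : R)^'+).
have : F [set yk | S `<=` (fun w => yk.2 < quad_form (G yk.1) w)].
  apply: (cov _ F (fun yk w => yk.2 < quad_form (G yk.1) w)) => w Sw.
  have w0 : w != 0 by rewrite -normr_eq0 Sw oner_eq0.
  have := Gpos w w0; set q := quad_form _ _ => q0.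
  have nq : \forall p \near (w, F), q / 2 < quad_form (G p.2.1) p.1.
    have : quad_form (G p.2.1) p.1 @[p --> (w, F)] --> q.
      apply: quad_form_cvg; last exact: cvg_fst.
      have p21 : p.2.1 @[p --> (w, F)] --> y.
        move=> A yA; exists (setT, [set p | A p.1]); last by move=> [? ?] [].
        split; first exact: filterT.
        by exists (A, setT); [split=> //; exact: filterT|move=> [? ?] []].
      exact: (continuous_cvg _ Gy p21).
    by move=> /cvgr_gt; apply; rewrite ltr_pdivrMr // ltr_pMr // ltr1n.
  have nk : \forall p \near (w, F), p.2.2 < q / 2.
    exists (setT, [set p | p.2 < q / 2]); last by move=> [? ?] [].
    split; first exact: filterT.
    exists (setT, [set k | k < q / 2]); last by move=> [? ?] [].
    by split; [exact: filterT|apply: nbhs_right_lt; rewrite divr_gt0].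
  by apply: filterS2 nq nk => -[w' [y' k]] /= ? ?; lra.
move=> [[A B] /= [yA B0] AB].
have [k [kB k0]] := filter_ex (filterI B0 (nbhs_right_gt 0)).
exists (Num.sqrt k); first by rewrite sqrtr_gt0.
apply: filterS yA => y' Ay' w.
have [->|w0] := eqVneq w 0; first by rewrite normr0 mulr0 sqrtr_ge0.
have nw : 0 < `|w| by rewrite normr_gt0.
have := AB (y', k) (conj Ay' kB) (`|w|^-1 *: w).
rewrite /S /= normrZ normfV normr_id mulVf ?gt_eqF // => /(_ erefl).
rewrite quad_formZ exprVn ltr_pdivlMl ?exprn_gt0 // => kw.
rewrite -[`|w|]gtr0_norm // -sqrtr_sqr -sqrtrM ?(ltW k0) //.
by rewrite ler_wsqrtr // mulrC ltW.
Qed.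

End QuadraticForms.

Section Gauges.
Variables (R : realType) (n : nat) (M : riemannianManifold R n).
Implicit Types (a c : mfd_index M) (x z : M) (v : 'rV[R]_n).

(** A rate along straight lines in charts that is at most L times the
Riemannian speed: for a differentiable rho this says that the Riemannian norm
of its gradient is at most L. The strict bound m on the speed absorbs the
errors of first order approximation. *)
Definition lipschitz_speed (rho : M -> R) (L : R) : Prop :=
  forall a x v m, chart_dom (mfd_chart a) x -> tangent_norm a x v < m ->
  \forall h \near (0 : R),
    `|rho (chart_inv (mfd_chart a) (h *: v + chart_map (mfd_chart a) x))
      - rho x| <= L * m * `|h|.

Lemma near_chart_line a x v (A : set M) : chart_dom (mfd_chart a) x ->
  nbhs x A -> \forall h \near (0 : R),
    A (chart_inv (mfd_chart a) (h *: v + chart_map (mfd_chart a) x)).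
Proof.
move=> ax xA.
apply: (near_line v (A := chart_inv (mfd_chart a) @^-1` A)).
apply: chart_inv_continuous; first exact: chart_img_map.
by rewrite chart_mapK.
Qed.

Lemma transition_differentiable a c x :
  chart_dom (mfd_chart a) x -> chart_dom (mfd_chart c) x ->
  differentiable (transition (mfd_chart a) (mfd_chart c))
    (chart_map (mfd_chart a) x).
Proof.
move=> ax cx.
apply: C1_differentiable (mfd_compat (s := M) a c 1%N) _; last by exists x.
by apply: chart_img_open_sub; exact: chart_dom_open.
Qed.

Lemma tangent_norm_transition a c x v :
  chart_dom (mfd_chart a) x -> chart_dom (mfd_chart c) x ->
  tangent_norm a x v = tangent_norm c x
    ('D_v (transition (mfd_chart a) (mfd_chart c)) (chart_map (mfd_chart a) x)).
Proof.
move=> ax cx; rewrite deriveEjacobian; last exact: transition_differentiable.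
rewrite /tangent_norm /tangent_dot (metric_compat ax cx).
by rewrite trmx_mul !mulmxA.
Qed.

(** In the chart c the Euclidean speed is at most k^-1 times the Riemannian
speed, and the latter can be computed in the chart a in which the line is
straight. Far from z the gauge is constant. *)
Lemma chart_gauge_speed c z (r k : R) :
  chart_dom (mfd_chart c) z -> 0 < r -> 0 < k ->
  (forall y, `|y - chart_map (mfd_chart c) z| <= r ->
     chart_img (mfd_chart c) y /\
     forall w, k * `|w| <= Num.sqrt (quad_form (metric c y) w)) ->
  lipschitz_speed (chart_gauge (mfd_chart c) z r) k^-1.
Proof.
move=> cz r0 k0 rk a x v m ax vm.
have rc y : `|y - chart_map (mfd_chart c) z| <= r -> chart_img (mfd_chart c) y.
  by move=> /rk[].
have m0 : 0 < m by apply: le_lt_trans vm; exact: sqrtr_ge0.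
have [xB|xB] := pselect (chart_ball (mfd_chart c)
    (chart_map (mfd_chart c) z) r x); last first.
  have nout := near_outside_chart_ball (@mfd_hausdorff _ _ M) r0 rc xB.
  apply: filterS (near_chart_line v ax nout) => h hB.
  rewrite !chart_gauge_out // subrr normr0.
  by rewrite !mulr_ge0 // ?invr_ge0 ltW.
have [cx xr] := xB.
set T := transition (mfd_chart a) (mfd_chart c).
set y := chart_map (mfd_chart a) x.
have Ty : T y = chart_map (mfd_chart c) x.
  by rewrite /T /transition /= /y chart_mapK.
have dT : derivable T y v.
  by apply: diff_derivable; exact: transition_differentiable.
have kD : k * `|'D_v T y| <= tangent_norm a x v.
  rewrite (tangent_norm_transition v ax cx).
  by have [_] := rk _ xr; apply.
pose e := (m - tangent_norm a x v) / k.
have e0 : 0 < e by rewrite divr_gt0 // subr_gt0.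
apply: filterS2 (derivable_near dT e0)
  (near_chart_line v ax (chart_dom_nbhs cx)) => h hT hc.
have hTm : `|T (h *: v + y) - T y| <= k^-1 * m * `|h|.
  have -> : T (h *: v + y) - T y =
      (T (h *: v + y) - T y - h *: 'D_v T y) + h *: 'D_v T y by rewrite subrK.
  apply: le_trans (ler_normD _ _) _; rewrite normrZ.
  have D1 : `|'D_v T y| <= k^-1 * tangent_norm a x v.
    by rewrite ler_pdivlMl.
  have D2 : `|h| * `|'D_v T y| <= `|h| * (k^-1 * tangent_norm a x v).
    by rewrite ler_wpM2l.
  apply: le_trans (lerD hT D2) _; rewrite /e.
  by lra.
rewrite !chart_gauge_in // -Ty.
set A := T (h *: v + y) in hTm *.
have -> : chart_map (mfd_chart c) (chart_inv (mfd_chart a) (h *: v + y)) = A.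
  by [].
set p := chart_map (mfd_chart c) z.
apply: le_trans hTm.
have : `| `|A - p| - `|T y - p| | <= `|A - T y|.
  by apply: le_trans (ler_dist_dist _ _) _; rewrite opprB addrA subrK.
rewrite !ler_norml => /andP[? ?].
rewrite /Num.min; case: ifPn => ?; case: ifPn => ?; apply/andP; split; lra.
Qed.

Lemma gauge_exists z : exists rho : M -> R, exists L : R,
  [/\ 0 <= L, continuous rho, rho z = 0,
      forall U, nbhs z U ->
        exists2 e : R, 0 < e & forall x, `|rho x| < e -> U x &
      lipschitz_speed rho L].
Proof.
have [c cz] := mfd_cover (s := M) z.
have cy := chart_img_map cz.
have Gy : {for chart_map (mfd_chart c) z, continuous (metric c)}.
  by have [cG _] := metric_smooth (r := M) c 0; apply: cG.
have [|k k0 nk] := quad_form_coercive Gy.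
  by move=> w; exact: metric_posdef.
have [r r0 rk] := nbhs_closed_norm_ball (filterI (chart_img_nbhs cy) nk).
have rc y : `|y - chart_map (mfd_chart c) z| <= r -> chart_img (mfd_chart c) y.
  by move=> /rk[].
exists (chart_gauge (mfd_chart c) z r), k^-1; split.
- by rewrite invr_ge0 ltW.
- by apply: chart_gauge_continuous => //; exact: mfd_hausdorff.
- exact: chart_gauge_self.
- by move=> U; exact: chart_gauge_nbhs.
- exact: chart_gauge_speed.
Qed.

End Gauges.

(** * The potential *)
Section Primitive.
Variables (R : realType) (b : R) (phi Phi : R -> R).
Hypothesis phi_gt0 : forall t, t <= b -> 0 < phi t.
Hypothesis Phi_primitive : forall t, t <= b ->
  (Phi s - Phi t) / (s - t) @[s --> within `]-oo, b] t^'] --> phi t.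

Lemma primitive_near t e : t <= b -> 0 < e -> \forall s \near t, s <= b ->
  `|Phi s - Phi t - phi t * (s - t)| <= e * `|s - t|.
Proof.
move=> tb e0; have /cvgrPdistC_lt/(_ e e0) nt := Phi_primitive tb.
have {}nt : \forall s \near t, s != t -> s <= b ->
    `|(Phi s - Phi t) / (s - t) - phi t| < e.
  move: nt; rewrite near_withinE near_withinE.
  by apply: filterS => s + st sb; apply=> //=; rewrite in_itv.
apply: filterS nt => s + sb.
have [->|st /(_ isT sb)] := eqVneq s t.
  by rewrite !subrr mulr0 subrr !normr0 mulr0.
have st0 : s - t != 0 by rewrite subr_eq0.
have -> : Phi s - Phi t - phi t * (s - t) =
    ((Phi s - Phi t) / (s - t) - phi t) * (s - t) by rewrite mulrBl divfK.
by rewrite normrM => /ltW h; rewrite ler_wpM2r.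
Qed.

(** Any m < phi t absorbs the error of the linear approximation of Phi at t; at
t = b only the points s <= b are concerned. *)
Lemma primitive_slope t m : t <= b -> m < phi t -> \forall s \near t, s <= b ->
  (t <= s -> m * (s - t) <= Phi s - Phi t) /\
  (s <= t -> m * (t - s) <= Phi t - Phi s).
Proof.
move=> tb mt; have e0 : 0 < phi t - m by rewrite subr_gt0.
apply: filterS (primitive_near tb e0) => s + sb => /(_ sb).
rewrite ler_norml => /andP[h1 h2]; split=> st; move: h1 h2.
  by rewrite ger0_norm ?subr_ge0 // => ? ?; lra.
by rewrite ler0_norm ?subr_le0 // => ? ?; lra.
Qed.

Lemma primitive_le s t : s <= t -> t <= b -> Phi s <= Phi t.
Proof.
move=> st tb; rewrite -lerN2.
apply: (@local_nonincreasing R (fun t => - Phi t) s t) => // u /andP[_ ut].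
have ub := le_trans ut tb.
apply: filterS (primitive_slope ub (phi_gt0 ub)) => u' h /andP[_ u't].
have [h1 h2] := h (le_trans u't tb).
by split=> uu; rewrite lerN2 -subr_ge0; [have := h1 uu|have := h2 uu];
  rewrite mul0r.
Qed.

Lemma primitive_lt s t : s < t -> t <= b -> Phi s < Phi t.
Proof.
move=> st tb; have m0 : 0 < phi t / 2 by rewrite divr_gt0 ?phi_gt0.
have mt : phi t / 2 < phi t by have := phi_gt0 tb; lra.
have [d /= d0 dt] := (nbhs_ballP _ _).1 (primitive_slope tb mt).
pose u := Num.max s (t - d / 2).
have ut : u < t by rewrite gt_max st; lra.
have su : s <= u by rewrite le_max lexx.
have tu : t - d / 2 <= u by rewrite le_max lexx orbT.
have ub : u <= b by apply: le_trans tb; exact: ltW.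
have [|_ /(_ (ltW ut)) h] := dt u _ ub.
  by rewrite /ball /= ger0_norm ?subr_ge0 ?(ltW ut) //; lra.
apply: le_lt_trans (primitive_le su ub) _; rewrite -subr_gt0.
by apply: lt_le_trans h; rewrite mulr_gt0 // subr_gt0.
Qed.

Lemma primitive_continuous t : t <= b ->
  Phi s @[s --> within [set s | s <= b] (nbhs t)] --> Phi t.
Proof.
move=> tb; have m0 : 0 < phi t + 1 by have := phi_gt0 tb; lra.
apply/cvgrPdistC_lt => e e0; rewrite near_withinE.
have nt : \forall s \near t, `|s - t| < e / (phi t + 1).
  have : s - t @[s --> t] --> (0 : R).
    by rewrite -(subrr t); apply: cvgB; [exact: cvg_id|exact: cvg_cst].
  move=> /cvgrPdistC_lt/(_ (e / (phi t + 1))); rewrite divr_gt0 // => /(_ isT).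
  by apply: filterS => s; rewrite subr0.
apply: filterS2 (primitive_near tb ltr01) nt => s h st sb.
have := h sb; move: st; rewrite ltr_pdivlMr // mul1r => st hs.
apply: le_lt_trans st.
have -> : Phi s - Phi t = (Phi s - Phi t - phi t * (s - t)) + phi t * (s - t).
  by rewrite subrK.
apply: le_trans (ler_normD _ _) _.
by rewrite normrM (gtr0_norm (phi_gt0 tb)); lra.
Qed.

End Primitive.

Section Potential.
Variables (R : realType) (n : nat) (M : riemannianManifold R n).
Variables (Sigma : set M) (b : R) (g : M -> R).
Hypothesis Sigma_closed : closed Sigma.
Hypothesis g_C2 : Ck_on_mfd 2 (~` Sigma) g.
Hypothesis g_Ny : forall z, Sigma z -> forall u : nat -> M,
  (forall k, ~ Sigma (u k)) -> u k @[k --> \oo] --> z ->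
  g (u k) @[k --> \oo] --> -oo.
Variables (phi Phi : R -> R) (C : R).
Hypothesis phi_gt0 : forall t, t <= b -> 0 < phi t.
Hypothesis phi_continuous : {within `]-oo, b], continuous phi}.
Hypothesis Phi_primitive : forall t, t <= b ->
  (Phi s - Phi t) / (s - t) @[s --> within `]-oo, b] t^'] --> phi t.
Hypothesis Phi_bounded : forall t, t <= b -> `|Phi t| <= C.

Definition sublevel : set M := [set x | ~ Sigma x /\ g x <= b] `|` Sigma.

Definition Phi_inf : R := inf (Phi @` [set t | t <= b]).

Definition potential (x : M) : R :=
  if `[< Sigma x >] then 0 else Phi (g x) - Phi_inf.

Lemma Phi_has_inf : has_inf (Phi @` [set t | t <= b]).
Proof.
split; first by exists (Phi b), b => //=.
exists (- C) => _ [t /= tb <-].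
by have := Phi_bounded tb; rewrite ler_norml => /andP[].
Qed.

Lemma potential_in x : Sigma x -> potential x = 0.
Proof. by rewrite /potential => /asboolP ->. Qed.

Lemma potential_out x : ~ Sigma x -> potential x = Phi (g x) - Phi_inf.
Proof. by rewrite /potential; case: asboolP. Qed.

Lemma Phi_inf_lt t : t <= b -> Phi_inf < Phi t.
Proof.
move=> tb; have t1 : t - 1 < t by lra.
apply: le_lt_trans (primitive_lt phi_gt0 Phi_primitive t1 tb).
by apply: (ge_inf Phi_has_inf.2); exists (t - 1) => //=; lra.
Qed.

Lemma potential_ge0 x : sublevel x -> 0 <= potential x.
Proof.
move=> [[xS xb]|xS]; last by rewrite potential_in.
by rewrite potential_out // subr_ge0 ltW // Phi_inf_lt.
Qed.

Lemma potential_eq0 x : sublevel x -> potential x = 0 -> Sigma x.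
Proof.
move=> [[xS xb]|//]; rewrite potential_out // => /eqP.
by rewrite subr_eq0 gt_eqF // Phi_inf_lt.
Qed.

Lemma potential_gt0 x : sublevel x -> 0 < potential x -> ~ Sigma x /\ g x <= b.
Proof. by move=> [//|xS]; rewrite potential_in // ltxx. Qed.

Definition outside_img a : set 'rV[R]_n :=
  chart_map (mfd_chart a) @` (chart_dom (mfd_chart a) `&` ~` Sigma).

Lemma outside_img_nbhs a y : outside_img a y -> nbhs y (outside_img a).
Proof.
move=> Uy; apply: open_nbhs_nbhs; split=> //.
by apply: chart_img_open_sub; exact: closed_openC.
Qed.

Lemma g_chart_continuous a y : outside_img a y ->
  {for y, continuous (g \o chart_inv (mfd_chart a))}.
Proof. by have [+ _] := g_C2 a; apply. Qed.

Lemma g_chart_differentiable a y : outside_img a y ->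
  differentiable (g \o chart_inv (mfd_chart a)) y.
Proof.
move=> Uy; apply: C1_differentiable (Uy).
  by apply: chart_img_open_sub; exact: closed_openC.
have [cG dG] := g_C2 a; split=> // i; have [di [ci _]] := dG i.
by split.
Qed.

Lemma g_continuous x : ~ Sigma x -> {for x, continuous g}.
Proof.
move=> xS; have [a ax] := mfd_cover (s := M) x.
have gy : {for chart_map (mfd_chart a) x,
    continuous (g \o chart_inv (mfd_chart a))}.
  by apply: g_chart_continuous; exists x.
have gE : \forall x' \near x,
    (g \o chart_inv (mfd_chart a)) (chart_map (mfd_chart a) x') = g x'.
  by apply: filterS (chart_dom_nbhs ax) => x' ax' /=; rewrite chart_mapK.
have gx := continuous_cvg _ gy (chart_map_continuous ax).
suff : g @ x --> g x by [].
have -> : g x = (g \o chart_inv (mfd_chart a)) (chart_map (mfd_chart a) x).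
  by rewrite /= chart_mapK.
by apply: (cvg_trans (near_eq_cvg gE)); move: gx; apply.
Qed.

(** The hypothesis on sequences gives a statement on neighbourhoods because z
has a countable base of neighbourhoods, the balls of radius 1 / (k + 1) in a
chart. *)
Lemma g_lt_near z (A : R) : Sigma z ->
  \forall x \near z, ~ Sigma x -> g x < A.
Proof.
move=> zS; have [c cz] := mfd_cover (s := M) z.
have cy := chart_img_map cz.
apply: contrapT => nzA.
pose near_z k x := [/\ chart_dom (mfd_chart c) x,
  `|chart_map (mfd_chart c) x - chart_map (mfd_chart c) z| < k.+1%:R^-1,
  ~ Sigma x & A <= g x].
have /choice[u uP] : forall k, exists x, near_z k x.
  move=> k; apply: contrapT => /forallNP nx; apply: nzA.
  have k0 : 0 < k.+1%:R^-1 :> R by rewrite invr_gt0.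
  have /cvgrPdistC_lt/(_ _ k0) cn := chart_map_continuous cz.
  apply: filterS2 cn (chart_dom_nbhs cz) => x xk cx xS.
  by rewrite ltNge; apply/negP => Ax; apply: (nx x).
have uS k : ~ Sigma (u k) by have [] := uP k.
have uz : u k @[k --> \oo] --> z.
  move=> U zU; have : nbhs (chart_map (mfd_chart c) z)
      (chart_inv (mfd_chart c) @^-1` U).
    by apply: chart_inv_continuous => //; rewrite chart_mapK.
  move=> /nbhs_closed_norm_ball[e e0 eU].
  apply: filterS (near_infty_natSinv_lt (PosNum e0)) => k /= ke.
  have [cu uk _ _] := uP k.
  by rewrite -(chart_mapK cu); apply: eU; rewrite ltW // (lt_trans uk).
have /cvgrNyPlt/(_ A)/filter_ex[k] := g_Ny zS uS uz.
by have [_ _ _] := uP k; rewrite leNgt => /negbTE ->.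
Qed.

Lemma potential_continuous x : sublevel x ->
  potential y @[y --> within sublevel (nbhs x)] --> potential x.
Proof.
move=> Kx; apply/cvgrPdistC_lt => e e0; rewrite near_withinE.
have [xS|xS] := pselect (Sigma x).
  rewrite potential_in //.
  have [_ [t /= tb <-] te] := inf_adherent e0 Phi_has_inf.
  apply: filterS (g_lt_near t xS) => y yt Ky; rewrite subr0.
  rewrite ger0_norm ?potential_ge0 //.
  have [yS|yS] := pselect (Sigma y); first by rewrite potential_in.
  rewrite potential_out // ltrBlDl; apply: le_lt_trans te.
  by apply: (primitive_le phi_gt0 Phi_primitive) => //; exact: ltW (yt yS).
have xb : g x <= b by case: Kx => [[]|].
have nS : nbhs x (~` Sigma).
  by apply: open_nbhs_nbhs; split=> //; exact: closed_openC.
have := primitive_continuous phi_gt0 Phi_primitive xb.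
move=> /cvgrPdistC_lt/(_ e e0); rewrite near_withinE => nP.
apply: filterS2 nS (g_continuous xS nP) => y yS yP Ky.
rewrite !potential_out // opprB addrA subrK; apply: yP.
by case: Ky => [[]|].
Qed.

(** * Pushing along straight lines in a chart *)

(** B is a set of coordinates of points off Sigma on which the direction v has
speed less than m, and in which E decreases at a rate greater than m along v
below the level b. *)
Section Line.
Variables (a : mfd_index M) (v : 'rV[R]_n) (m : R) (B : set 'rV[R]_n).
Let c := mfd_chart a.
Let G := g \o chart_inv c.
Hypothesis B_outside : forall y, B y -> outside_img a y.
Hypothesis B_speed : forall y, B y -> Num.sqrt (quad_form (metric a y) v) < m.
Hypothesis B_decreasing : forall y, B y -> 'D_v G y < 0.
Hypothesis B_steep : forall y, B y -> G y <= b -> m < phi (G y) * - 'D_v G y.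

Lemma B_img y : B y -> chart_img c y.
Proof. by move=> /B_outside[x [cx _] <-]; exists x. Qed.

Lemma B_inv_outside y : B y -> ~ Sigma (chart_inv c y).
Proof. by move=> /B_outside[x [cx xS] <-]; rewrite chart_mapK. Qed.

Lemma B_derivable y : B y -> derivable G y v.
Proof. by move=> By; apply/diff_derivable/g_chart_differentiable/B_outside. Qed.

(** First g decreases along the segment, so that it stays below the level b,
where phi and Phi are controlled. Then the rates at which g decreases and Phi
increases multiply to give that of E. *)
Lemma line_descent x mu : chart_dom c x -> 0 <= mu -> g x <= b ->
  (forall s, 0 <= s <= mu -> B (s *: v + chart_map c x)) ->
  let x' := chart_inv c (mu *: v + chart_map c x) in
  [/\ ~ Sigma x', g x' <= b,
      m * mu <= potential x - potential x' &
      forall rho L, lipschitz_speed rho L ->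
        `|rho x' - rho x| <= L * m * mu].
Proof.
move=> cx mu0 xb Bs x'.
pose pt s : 'rV[R]_n := s *: v + chart_map c x.
have pt0 : chart_inv c (pt 0) = x by rewrite /pt scale0r add0r chart_mapK.
have G0 : G (pt 0) = g x by rewrite /G /= pt0.
have mumu : 0 <= mu <= mu by rewrite mu0 lexx.
have Gb s : 0 <= s <= mu -> G (pt s) <= b.
  move=> /andP[s0 smu]; apply: le_trans xb; rewrite -G0.
  apply: (@local_nonincreasing R (G \o pt) 0 s) => // u /andP[u0 us].
  have Bu : B (pt u) by apply: Bs; rewrite u0 (le_trans us).
  have D0 := B_decreasing Bu; have e0 : 0 < - 'D_v G (pt u) by rewrite oppr_gt0.
  apply: filterS (line_near (B_derivable Bu) e0) => u' + _.
  rewrite -/(pt u) -/(pt u') /= ler_norml => /andP[h1 h2].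
  split=> uu; move: h1 h2.
    by rewrite ger0_norm ?subr_ge0 // /GRing.scale /= => _; lra.
  by rewrite ler0_norm ?subr_le0 // /GRing.scale /= => + _; lra.
split.
- exact: (B_inv_outside (Bs mu mumu)).
- exact: Gb.
- have xS : ~ Sigma x.
    by rewrite -pt0; apply: B_inv_outside; apply: Bs; rewrite lexx.
  rewrite (potential_out xS) (potential_out (B_inv_outside (Bs mu mumu))).
  have := @local_nonincreasing R (fun s => Phi (G (pt s)) + m * s) 0 mu.
  rewrite mulr0 addr0 G0 -[Phi (G (pt mu))]/(Phi (g x')) => main.
  suff : Phi (g x') + m * mu <= Phi (g x) by lra.
  apply: main => // s smu.
  have Bps : B (pt s) by exact: Bs.
  have tb := Gb s smu; set t := G (pt s) in tb *.
  have p0 := phi_gt0 tb; have D0 := B_decreasing Bps.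
  have mD := B_steep Bps tb; rewrite -/t in mD.
  have m0 : 0 < m by apply: le_lt_trans (B_speed Bps); exact: sqrtr_ge0.
  set q := - 'D_v G (pt s) in mD.
  have [p1 [q1 [p10 p1p q10 q1q mE]]] := lt_mul_split m0 p0 mD.
  have e0 : 0 < q - q1 by rewrite subr_gt0.
  have nG := line_near (B_derivable Bps) e0.
  have cG : G (pt s') @[s' --> s] --> t.
    apply: (continuous_cvg _ (g_chart_continuous (B_outside Bps))).
    by apply: cvgD; [apply: cvgZr_tmp; exact: cvg_id|exact: cvg_cst].
  have nP := cG _ (primitive_slope Phi_primitive tb p1p).
  apply: filterS2 nG nP => s'; rewrite -/(pt s) -/(pt s') -/t => h hP s'mu.
  have [h1 h2] := hP (Gb s' s'mu).
  have DE : 'D_v G (pt s) = - q by rewrite opprK.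
  move: h; rewrite DE /GRing.scale /= ler_norml => /andP[h3 h4].
  split=> ss.
    have ge : q1 * (s' - s) <= t - G (pt s').
      by move: h4; rewrite ger0_norm ?subr_ge0 //; lra.
    have tt : G (pt s') <= t.
      rewrite -subr_ge0; apply: le_trans ge.
      by rewrite mulr_ge0 ?subr_ge0 // ltW.
    have := h2 tt.
    have : p1 * (q1 * (s' - s)) <= p1 * (t - G (pt s')).
      by rewrite ler_wpM2l // ltW.
    by rewrite mulrA -mE; lra.
  have ge : q1 * (s - s') <= G (pt s') - t.
    by move: h3; rewrite ler0_norm ?subr_le0 //; lra.
  have tt : t <= G (pt s').
    by rewrite -subr_ge0; apply: le_trans ge; rewrite mulr_ge0 ?subr_ge0 // ltW.
  have := h1 tt.
  have : p1 * (q1 * (s - s')) <= p1 * (G (pt s') - t).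
    by rewrite ler_wpM2l // ltW.
  by rewrite mulrA -mE; lra.
- move=> rho L rhoL.
  have := @local_lipschitz R R (rho \o chart_inv c \o pt) (L * m) 0 mu _ mu0.
  rewrite /= pt0 subr0; apply => s smu.
  have Bps : B (pt s) by exact: Bs.
  have cs : chart_map c (chart_inv c (pt s)) = pt s.
    by apply: chart_invK; exact: B_img.
  have vm : tangent_norm a (chart_inv c (pt s)) v < m.
    by rewrite /tangent_norm /tangent_dot cs; exact: B_speed.
  have := rhoL a _ v m (chart_dom_inv (B_img Bps)) vm; rewrite cs => hs.
  apply: near0_shift; apply: filterS hs => h + _.
  by rewrite /pt addrA -scalerDl (addrC h s) (addrC s h) addrK (addrC h s).
Qed.

End Line.

Section BallPush.
Variables (a : mfd_index M) (y0 v : 'rV[R]_n) (r m : R).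
Let c := mfd_chart a.
Let G := g \o chart_inv c.
Let B : set 'rV[R]_n := [set y | `|y - y0| <= r].
Hypotheses (r0 : 0 < r) (m0 : 0 < m).
Hypothesis B_outside : forall y, B y -> outside_img a y.
Hypothesis B_speed : forall y, B y -> Num.sqrt (quad_form (metric a y) v) < m.
Hypothesis B_decreasing : forall y, B y -> 'D_v G y < 0.
Hypothesis B_steep : forall y, B y -> G y <= b -> m < phi (G y) * - 'D_v G y.

Lemma ball_img y : `|y - y0| <= r -> chart_img c y.
Proof. by move=> /B_outside[x [cx _] <-]; exists x. Qed.

(** With the factor (1 + | v |)^-1, the segment from x travelled in this time is
no longer than the distance from x to the boundary of the ball. *)
Definition push_time (x : M) (t : R) : R :=
  clamp t * ((1 + `|v|)^-1 * Num.max 0 (r - `|chart_map c x - y0|)).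

Definition ball_push (p : M * R) : M :=
  if `[< chart_dom c p.1 >]
  then chart_inv c (push_time p.1 p.2 *: v + chart_map c p.1) else p.1.

Lemma push_time_ge0 x t : 0 <= push_time x t.
Proof.
by rewrite mulr_ge0 ?clamp_ge0 // mulr_ge0 ?le_max ?lexx.
Qed.

Lemma ball_push_in x t : chart_dom c x ->
  ball_push (x, t) = chart_inv c (push_time x t *: v + chart_map c x).
Proof. by rewrite /ball_push /= => /asboolP ->. Qed.

Lemma ball_push_out x t : ~ chart_ball c y0 r x -> ball_push (x, t) = x.
Proof.
move=> xr; rewrite /ball_push /=; case: asboolP => // cx.
have rx : r - `|chart_map c x - y0| <= 0.
  by rewrite subr_le0 leNgt; apply/negP => /ltW xr'; apply: xr.
by rewrite /push_time (max_idPl rx) !mulr0 scale0r add0r chart_mapK.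
Qed.

Lemma ball_push_line x t s : chart_ball c y0 r x -> 0 <= s <= push_time x t ->
  B (s *: v + chart_map c x).
Proof.
move=> [cx xr] /andP[s0 st]; rewrite /B /= -addrA.
apply: le_trans (ler_normD _ _) _; rewrite -lerBrDr normrZ ger0_norm //.
have v1 : 0 < 1 + `|v| by rewrite ltr_pwDl.
set d := r - _; have d0 : 0 <= d by rewrite subr_ge0.
have sd : s <= (1 + `|v|)^-1 * d.
  apply: le_trans st _; rewrite /push_time -/d (max_idPr d0).
  by rewrite ler_piMl ?clamp_le1 // mulr_ge0 // invr_ge0 ltW.
apply: le_trans (ler_wpM2r (normr_ge0 v) sd) _.
by rewrite mulrAC ler_piMl // ler_pdivrMl // mulr1 lerDr.
Qed.

Lemma ball_push_moves x t : sublevel x -> chart_ball c y0 r x ->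
  [/\ sublevel (ball_push (x, t)),
      m * push_time x t <= potential x - potential (ball_push (x, t)) &
      forall rho L, lipschitz_speed rho L ->
        `|rho (ball_push (x, t)) - rho x| <= L * m * push_time x t].
Proof.
move=> Kx xB; have [cx xr] := xB.
have xb : g x <= b.
  have /B_outside[x' [cx' x'S] xx'] : B (chart_map c x) by [].
  case: Kx => [[]//|xS]; case: x'S.
  by rewrite -(chart_mapK cx') xx' chart_mapK.
have [xS xb' E_drop rho_small] := line_descent B_outside B_speed B_decreasing
  B_steep cx (push_time_ge0 x t) xb (fun s => @ball_push_line x t s xB).
by rewrite ball_push_in //; split=> //; left.
Qed.

(** On the open domain of the chart the push is given by one formula, which
outside the ball is the identity; a point outside the domain has a
neighbourhood that avoids the ball, as the latter is closed in M. *)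
Lemma ball_push_continuous x t : {for (x, t), continuous ball_push}.
Proof.
suff : ball_push p @[p --> (x, t)] --> ball_push (x, t) by [].
have [cx|ncx] := pselect (chart_dom c x); last first.
  have xB : ~ chart_ball c y0 r x by case.
  have nE : \forall p \near (x, t), p.1 = ball_push p.
    have nB := near_outside_chart_ball (@mfd_hausdorff _ _ M) r0 ball_img xB.
    exists (~` chart_ball c y0 r, setT); first by split=> //; exact: filterT.
    by move=> [x' t'] /= [x'B _]; rewrite ball_push_out.
  rewrite ball_push_out //.
  by apply: (cvg_trans (near_eq_cvg nE)); exact: cvg_fst.
pose target (p : M * R) := push_time p.1 p.2 *: v + chart_map c p.1.
have nE : \forall p \near (x, t), chart_inv c (target p) = ball_push p.
  exists (chart_dom c, setT).
    by split; [exact: chart_dom_nbhs|exact: filterT].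
  by move=> [x' t'] /= [cx' _]; rewrite ball_push_in.
have cvgc : chart_map c p.1 @[p --> (x, t)] --> chart_map c x.
  by apply: (continuous_cvg _ (chart_map_continuous cx)); exact: cvg_fst.
have cvg_target : target p @[p --> (x, t)] --> target (x, t).
  apply: cvgD => //; apply: cvgZr_tmp; apply: cvgM.
    by apply: (continuous_cvg _ (@clamp_continuous R t)); exact: cvg_snd.
  apply: cvgMl_tmp.
  have d_cvg : r - `|chart_map c p.1 - y0| @[p --> (x, t)] -->
      r - `|chart_map c x - y0|.
    apply: cvgB; first exact: cvg_cst.
    by apply: cvg_norm; apply: cvgB => //; exact: cvg_cst.
  by apply: (@continuous_max R (M * R)%type (fun=> 0)
    (fun p => r - `|chart_map c p.1 - y0|)) => //; exact: cvg_cst.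
have target_img : chart_img c (target (x, t)).
  have [xB|xB] := pselect (chart_ball c y0 r x).
    apply: ball_img; apply: (ball_push_line (t := t) xB).
    by rewrite push_time_ge0 lexx.
  have rx : r - `|chart_map c x - y0| <= 0.
    by rewrite subr_le0 leNgt; apply/negP => /ltW xr'; apply: xB.
  rewrite /target /push_time /= (max_idPl rx) !mulr0 scale0r add0r.
  exact: chart_img_map.
rewrite ball_push_in //; apply: (cvg_trans (near_eq_cvg nE)).
exact: (continuous_cvg _ (chart_inv_continuous target_img) cvg_target).
Qed.

Lemma ball_pushP (gauge : M -> M -> R) (L : M -> R) :
  (forall z, 0 <= L z) -> (forall z, lipschitz_speed (gauge z) (L z)) ->
  push sublevel potential gauge L ball_push.
Proof.
move=> L0 gL; split=> [x t Kx|x Kx|x t Kx|x t Kx].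
- have [xB|xB] := pselect (chart_ball c y0 r x); last by rewrite ball_push_out.
  by have [] := ball_push_moves t Kx xB.
- have [cx|ncx] := pselect (chart_dom c x); last first.
    by rewrite ball_push_out // => -[].
  rewrite ball_push_in // /push_time clamp_eq0 // mul0r scale0r add0r.
  exact: chart_mapK.
- have [xB|xB] := pselect (chart_ball c y0 r x); last first.
    by rewrite ball_push_out //; exact: descends_refl.
  have [_ E_drop rho_small] := ball_push_moves t Kx xB.
  have mt0 : 0 <= m * push_time x t by rewrite mulr_ge0 ?push_time_ge0 ?ltW.
  split=> [|z]; first by rewrite -subr_ge0 (le_trans mt0).
  apply: le_trans (rho_small _ _ (gL z)) _.
  by rewrite -mulrA ler_wpM2l.
- by apply: cvg_within_filter; exact: ball_push_continuous.
Qed.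

Lemma ball_push_strict p : sublevel p -> chart_dom c p -> chart_map c p = y0 ->
  potential (ball_push (p, 1)) < potential p.
Proof.
move=> Kp cp py0.
have pB : chart_ball c y0 r p by split=> //; rewrite py0 subrr normr0 ltW.
have [_ E_drop _] := ball_push_moves 1 Kp pB.
rewrite -subr_gt0; apply: lt_le_trans E_drop; rewrite mulr_gt0 //.
rewrite /push_time clamp_eq1 // mul1r mulr_gt0 //.
by rewrite lt_max py0 subrr normr0 subr0 r0 orbT.
Qed.

End BallPush.

Hypothesis gradient_large : forall x, ~ Sigma x -> g x <= b ->
  forall a, chart_dom (mfd_chart a) x ->
    1 / phi (g x) < tangent_norm a x (gradient_coord a g x).

(** Expresses the derivative of g in a fixed direction by partial derivatives,
whose continuity is known. *)
Lemma derive_g_partial a v y : outside_img a y ->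
  'D_v (g \o chart_inv (mfd_chart a)) y =
    \sum_i v 0 i * partial i (g \o chart_inv (mfd_chart a)) y.
Proof.
move=> /g_chart_differentiable dG.
rewrite deriveE // [v in LHS]row_sum_delta linear_sum.
by apply: eq_bigr => i _; rewrite linearZ /= /partial deriveE.
Qed.

Lemma derive_g_continuous a v y : outside_img a y ->
  'D_v (g \o chart_inv (mfd_chart a)) y' @[y' --> y] -->
  'D_v (g \o chart_inv (mfd_chart a)) y.
Proof.
move=> Uy; rewrite derive_g_partial //.
have nE : \forall y' \near y,
    \sum_i v 0 i * partial i (g \o chart_inv (mfd_chart a)) y' =
    'D_v (g \o chart_inv (mfd_chart a)) y'.
  by apply: filterS (outside_img_nbhs Uy) => y' Uy'; rewrite derive_g_partial.
apply: (cvg_trans (near_eq_cvg nE)).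
apply: cvg_big => [|i _]; first exact: add_continuous.
apply: cvgMl_tmp; have [_ /(_ i)[_ [ci _]]] := g_C2 a.
exact: ci.
Qed.

Lemma derive_g_gradient a x v : chart_dom (mfd_chart a) x -> ~ Sigma x ->
  'D_v (g \o chart_inv (mfd_chart a)) (chart_map (mfd_chart a) x) =
  tangent_dot a x (gradient_coord a g x) v.
Proof.
move=> ax xS; rewrite derive_g_partial; last by exists x.
have [/(_ erefl) -> _] := gradient_coordP g ax (gradient_coord a g x).
by rewrite mxE; apply: eq_bigr => i _; rewrite !mxE mulrC.
Qed.

(** Take v = - grad g(p) in a chart at p and let N = | grad g(p) |. At p the
speed of v is N, and g decreases at the rate N^2 along v, hence E at the rate
phi(g p) N^2, which exceeds N because N > 1 / phi(g p). Any m strictly between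
these two numbers separates the speed from the rate of E near p as well. *)
Lemma descending_ball p : ~ Sigma p -> g p <= b ->
  exists a v r m, [/\ chart_dom (mfd_chart a) p, 0 < r, 0 < m &
    forall y, `|y - chart_map (mfd_chart a) p| <= r ->
    [/\ outside_img a y,
        Num.sqrt (quad_form (metric a y) v) < m,
        'D_v (g \o chart_inv (mfd_chart a)) y < 0 &
        g (chart_inv (mfd_chart a) y) <= b ->
        m < phi (g (chart_inv (mfd_chart a) y)) *
            - 'D_v (g \o chart_inv (mfd_chart a)) y]].
Proof.
move=> pS pb; have [a ap] := mfd_cover (s := M) p.
pose c := mfd_chart a; pose y0 := chart_map c p; pose G := g \o chart_inv c.
pose w := gradient_coord a g p; pose N := tangent_norm a p w.
have p0 := phi_gt0 pb.
have pN := gradient_large pS pb ap; rewrite -/w -/N in pN.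
have N0 : 0 < N by apply: lt_trans pN; rewrite divr_gt0.
have Uy0 : outside_img a y0 by exists p.
have DN : - 'D_(- w) G y0 = N ^+ 2.
  rewrite derive_g_gradient // -/w /N /tangent_norm sqr_sqrtr.
    by rewrite /tangent_dot linearN /= mulmxN mxE opprK.
  by rewrite ltW // -sqrtr_gt0.
have NpN : N < phi (g p) * N ^+ 2.
  rewrite expr2 mulrA ltr_pMl // -ltr_pdivrMl // mulr1.
  by move: pN; rewrite div1r.
pose m := (N + phi (g p) * N ^+ 2) / 2.
have Nm : N < m by rewrite /m; lra.
have mN : m < phi (g p) * N ^+ 2 by rewrite /m; lra.
have m0 : 0 < m := lt_trans N0 Nm.
have nU := outside_img_nbhs Uy0.
have nspeed : \forall y \near y0, Num.sqrt (quad_form (metric a y) (- w)) < m.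
  have cG : {for y0, continuous (metric a)}.
    by have [mG _] := metric_smooth (r := M) a 0; apply: mG; exists p.
  have cf : quad_form (metric a y) (- w) @[y --> y0] -->
      quad_form (metric a y0) (- w).
    exact: (quad_form_cvg _ cG (cvg_cst _)).
  have cs : Num.sqrt (quad_form (metric a y) (- w)) @[y --> y0] --> N.
    have -> : N = Num.sqrt (quad_form (metric a y0) (- w)).
      by rewrite -scaleN1r quad_formZ sqrrN expr1n mul1r.
    exact: (continuous_cvg _ (@sqrt_continuous R _) cf).
  by move: cs => /cvgr_lt; apply.
have cD : 'D_(- w) G y @[y --> y0] --> 'D_(- w) G y0.
  exact: derive_g_continuous.
have D0 : 'D_(- w) G y0 < 0.
  by rewrite -oppr_gt0 DN exprn_gt0.
have ndecr : \forall y \near y0, 'D_(- w) G y < 0.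
  by move: cD => /cvgr_lt; apply.
have [p1 [q1 [p10 p1p q10 q1N mE]]] := lt_mul_split m0 p0 mN.
have nq1 : \forall y \near y0, q1 < - 'D_(- w) G y.
  have : - 'D_(- w) G y @[y --> y0] --> N ^+ 2 by rewrite -DN; exact: cvgN cD.
  by move=> /cvgr_gt; apply.
have nphi : \forall y \near y0, G y <= b -> p1 < phi (G y).
  have Gy0 : G y0 = g p by rewrite /G /= chart_mapK.
  have cG : G y @[y --> y0] --> g p.
    by rewrite -Gy0; exact: g_chart_continuous.
  have cphi : phi t @[t --> within `]-oo, b] (nbhs (g p))] --> phi (g p).
    by move/subspace_continuousP: phi_continuous; apply; rewrite /= in_itv.
  have /cvgr_gt/(_ _ p1p) := cphi; rewrite near_withinE => nt.
  have nGy : \forall y \near y0, G y \in `]-oo, b] -> p1 < phi (G y).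
    exact: cG _ nt.
  by apply: filterS nGy => y + yb; apply; rewrite in_itv.
have [r r0 rB] := nbhs_closed_norm_ball
  (filterI nU (filterI nspeed (filterI ndecr (filterI nq1 nphi)))).
exists a, (- w), r, m; split=> // y /rB [? [? [? [hq hphi]]]]; split=> // yb.
rewrite mE; apply: ltr_pM; [exact: ltW|exact: ltW|exact: hphi|exact: hq].
Qed.

Lemma potential_push (gauge : M -> M -> R) (L : M -> R) p :
  (forall z, 0 <= L z) -> (forall z, lipschitz_speed (gauge z) (L z)) ->
  sublevel p -> 0 < potential p ->
  exists2 h, push sublevel potential gauge L h &
    potential (h (p, 1)) < potential p.
Proof.
move=> L0 gL Kp /(potential_gt0 Kp)[pS pb].
have [a [v [r [m [ap r0 m0 B]]]]] := descending_ball pS pb.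
exists (ball_push a (chart_map (mfd_chart a) p) v r).
  apply: (ball_pushP (m := m)) => // y By; by have [] := B y By.
apply: (ball_push_strict (m := m)) => // y By; by have [] := B y By.
Qed.

End Potential.

Theorem lemma3 (R : realType) (n : nat) (M : riemannianManifold R n)
    (Sigma : set M) (b : R) (g : M -> R)
    (Sigma_compact : compact Sigma)
    (g_C2 : Ck_on_mfd 2 (~` Sigma) g)
    (g_fast : fast_decreasing g Sigma b)
    (sublevel_compact :
       compact ([set x | ~ Sigma x /\ g x <= b] `|` Sigma)) :
  strong_deformation_retract R Sigma
    ([set x | ~ Sigma x /\ g x <= b] `|` Sigma).
Proof.
have Sigma_closed : closed Sigma.
  by apply: compact_closed => //; exact: mfd_hausdorff.
have [g_Ny [phi [phi_gt0 phi_cont [Phi [Phi_prim [C Phi_C]]] grad]]] := g_fast.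
have /choice[gauge gaugeL] := @gauge_exists R n M.
have /choice[L gaugeP] := gaugeL.
pose E := potential Sigma b g Phi.
have := @pushes_retract R M (sublevel Sigma b g) E gauge L.
have -> : [set x | sublevel Sigma b g x /\ E x = 0] = Sigma.
  apply/seteqP; split=> x.
    move=> [Kx]; exact: (potential_eq0 phi_gt0 Phi_prim Phi_C Kx).
  by move=> xS; split; [right|exact: potential_in].
apply.
- exact: mfd_hausdorff.
- by [].
- by move=> x; exact: (potential_ge0 phi_gt0 Phi_prim Phi_C).
- move=> x.
  exact: (potential_continuous Sigma_closed g_C2 g_Ny phi_gt0 Phi_prim Phi_C).
- by move=> z; have [] := gaugeP z.
- by move=> z; have [] := gaugeP z.
- by move=> z; have [] := gaugeP z.
- by move=> z; have [] := gaugeP z.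
- move=> p.
  apply: (potential_push Sigma_closed g_C2 phi_gt0 phi_cont Phi_prim) => // z.
    by have [] := gaugeP z.
  by have [] := gaugeP z.
Qed.
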